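(* Let $p(\cdot)\in\mathcal{P}$ with $p(\cdot)\in LH$ and $p_->1$. Then $\mathcal{A}_{p(\cdot)}\subsetneqq\mathcal{A}_{p(\cdot),\infty}\subsetneqq A_\infty$.
   Context: Everything is on $\mathbb{R}^n$. $\mathcal{P}$ is the set of measurable $p:\mathbb{R}^n\to[1,\infty]$; $p_-:=\operatorname{ess\,inf}_{x\in\mathbb{R}^n}p(x)$; $p'(\cdot)$ is defined by $\frac1{p(x)}+\frac1{p'(x)}=1$. A measurable real-valued function $r$ on $\mathbb{R}^n$ belongs to $LH$ if there is $C_0>0$ with $|r(x)-r(y)|\le -\frac{C_0}{\log|x-y|}$ whenever $|x-y|<\frac12$, and there are positive constants $r_\infty,C_\infty$ with $|r(x)-r_\infty|\le\frac{C_\infty}{\log(e+|x|)}$ for all $x$. For a measurable function $f$ and exponent $q(\cdot)$, $\|f\|_{L^{q(\cdot)}}:=\inf\{\lambda>0:\int_{\mathbb{R}^n}|f(x)/\lambda|^{q(x)}\,dx\le1\}$ (with $\inf\emptyset=\infty$). Cubes have finite positive edge length and edges parallel to the axes (not necessarily open or closed); $\fint_Q$ denotes the average $\frac1{|Q|}\int_Q$. A scalar weight is a non-negative measurable function on $\mathbb{R}^n$ that is positive almost everywhere. With suprema over all cubes (a product $\infty\cdot0$ being understood as $\infty$), the following are classes of scalar weights $w$: $\mathcal{A}_{p(\cdot)}$ is the class with $\sup_Q\frac1{|Q|}\|w\mathbf{1}_Q\|_{L^{p(\cdot)}}\|w^{-1}\mathbf{1}_Q\|_{L^{p'(\cdot)}}<\infty$;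 $\mathcal{A}_{p(\cdot),\infty}$ is the class with $$\sup_Q\frac{1}{\|\mathbf{1}_Q\|_{L^{p(\cdot)}}}\|w\mathbf{1}_Q\|_{L^{p(\cdot)}}\exp\left(\fint_Q\log(w^{-1}(y))\,dy\right)<\infty;$$ $A_\infty$ is the class with $\sup_Q\fint_Qw(x)\,dx\,\exp\left(\fint_Q\log(w^{-1}(x))\,dx\right)<\infty$. *)

(* Defs.v *)
From HB Require Import structures.
From mathcomp Require Import all_boot all_order all_algebra.
From mathcomp Require Import all_classical all_reals all_analysis.
From mathcomp Require Import measurable_realfun ess_sup_inf.

Set Implicit Arguments.
Unset Strict Implicit.
Unset Printing Implicit Defensive.

Import Order.TTheory GRing.Theory Num.Def Num.Theory.
Import numFieldNormedType.Exports.

Local Open Scope classical_set_scope.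
Local Open Scope ring_scope.

(* Lebesgue measure on the Borel sets of R^n: the n-fold product of the
   one-dimensional Lebesgue measure, carried to tuples by consing. *)
Section borel_lebesgue.
Context {R : realType}.
Local Notation R1 := (measurableTypeR R).

Definition tcons n (x : R1 * n.-tuple R1) : n.+1.-tuple R1 :=
  [tuple of x.1 :: x.2].

Lemma measurable_tcons n : measurable_fun [set: R1 * n.-tuple R1] (@tcons n).
Proof. exact: measurable_cons. Qed.

Section step.
Context n (m : {sigma_finite_measure set (n.-tuple R1) -> \bar R}).

Definition lebesgue_step : set (n.+1.-tuple R1) -> \bar R :=
  pushforward (@lebesgue_measure R \x m)%E (@tcons n).

Let lebesgue_step0 : lebesgue_step set0 = 0%E.
Proof. by rewrite /lebesgue_step /pushforward preimage_set0 measure0. Qed.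

Let lebesgue_step_ge0 A : (0 <= lebesgue_step A)%E.
Proof. by rewrite /lebesgue_step /pushforward measure_ge0. Qed.

Let lebesgue_step_sigma_additive : semi_sigma_additive lebesgue_step.
Proof.
move=> F mF tF mUF; rewrite /lebesgue_step /pushforward preimage_bigcup.
have mE i : measurable (@tcons n @^-1` F i).
  by rewrite -[X in measurable X]setTI; apply: measurable_tcons.
apply: measure_semi_sigma_additive => //; last exact: bigcup_measurable.
apply/trivIsetP => i j _ _ ij; rewrite -preimage_setI.
by move/trivIsetP : tF => /(_ _ _ _ _ ij) -> //; rewrite preimage_set0.
Qed.

HB.instance Definition _ := isMeasure.Build _ _ _ lebesgue_step
  lebesgue_step0 lebesgue_step_ge0 lebesgue_step_sigma_additive.

Let lebesgue_step_sigma_finite : sigma_finite setT lebesgue_step.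
Proof.
have /sigma_finiteP[F [TF ndF Foo]] := sigma_finiteT (@lebesgue_measure R).
have /sigma_finiteP[G [TG ndG Goo]] := sigma_finiteT m.
pose h (t : n.+1.-tuple R1) : R1 * n.-tuple R1 :=
  (thead t, [tuple of behead t]).
have mh : measurable_fun setT h.
  by apply/measurable_fun_pair; [exact: measurable_tnth|
    exact: measurable_behead].
have hK x : h (tcons x) = x.
  by case: x => x t; rewrite /h /tcons theadE; congr (_, _); exact: val_inj.
exists (fun k => h @^-1` (F k `*` G k)).
  apply/esym; rewrite -subTset => t _.
  have [i _ Fi] : (\bigcup_i F i) (h t).1 by rewrite -TF.
  have [j _ Gj] : (\bigcup_i G i) (h t).2 by rewrite -TG.
  exists (maxn i j) => //; split.
  - by have /subsetPset := ndF _ _ (leq_maxl i j); exact.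
  - by have /subsetPset := ndG _ _ (leq_maxr i j); exact.
move=> k; have [mF Fy] := Foo k; have [mG Gy] := Goo k; split.
  by rewrite -[X in measurable X]setTI; apply: mh => //; exact: measurableX.
rewrite /lebesgue_step /pushforward -comp_preimage.
rewrite (_ : h \o _ = id); last by apply/funext => x; exact: hK.
by rewrite preimage_id product_measure1E// lte_mul_pinfty// ge0_fin_numE.
Qed.

HB.instance Definition _ := Measure_isSigmaFinite.Build _ _ _ lebesgue_step
  lebesgue_step_sigma_finite.
End step.

Fixpoint borel_lebesgue n : {sigma_finite_measure set (n.-tuple R1) -> \bar R} :=
  match n with
  | 0 => \d_([tuple] : 0.-tuple R1)
  | n'.+1 => lebesgue_step (borel_lebesgue n')
  end.

End borel_lebesgue.

(* R^n with its Lebesgue-measurable sets (the Caratheodory sets of the outer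
   measure), so that measurable_fun is Lebesgue measurability. *)
Definition Rn (R : realType) (n : nat) : Type :=
  caratheodory_type ((@borel_lebesgue R n)^*)%mu.

HB.instance Definition _ (R : realType) (n : nat) := Measurable.on (Rn R n).

Definition lebesgue_Rn (R : realType) (n : nat) : set (Rn R n) -> \bar R :=
  @completed_measure_extension _ _ _ (@borel_lebesgue R n).

HB.instance Definition _ (R : realType) (n : nat) :=
  Measure.on (@lebesgue_Rn R n).

Section variable_exponent.
Context {R : realType} {n : nat}.
Local Notation Rn := (Rn R n).
Local Notation mu := (@lebesgue_Rn R n).
Implicit Types (x y : Rn) (w r : Rn -> R) (p q f g : Rn -> \bar R) (Q : set Rn).

Definition coord (x : Rn) (i : 'I_n) : R := tnth (x : n.-tuple R) i.

Definition enorm x : R := Num.sqrt (\sum_(i < n) coord x i ^+ 2).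

Definition edist x y : R :=
  Num.sqrt (\sum_(i < n) (coord x i - coord y i) ^+ 2).

(* The constructor BSide only decides whether an endpoint is included, so the
   two families of booleans range over all open/closed/half-open cubes. *)
Definition cube Q : Prop :=
  exists (a : 'I_n -> R) (l : R) (bl br : 'I_n -> bool), 0 < l /\
    Q = [set x | forall i : 'I_n,
      coord x i \in Interval (BSide (bl i) (a i)) (BSide (br i) (a i + l))].

Definition exponent p : Prop :=
  measurable_fun [set: Rn] p /\ forall x, (1 <= p x)%E.

Definition conj_exponent p : Rn -> \bar R := fun x => hoelder_conjugate (p x).

(* At x = y the local bound reads 0 <= 0, because ln 0 = 0 and 0^-1 = 0 in R;
   this agrees with the convention -C0 / log 0 = 0. *)
Definition LH r : Prop :=
  [/\ measurable_fun [set: Rn] r,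
      exists2 C0 : R, 0 < C0 & forall x y, edist x y < 2^-1 ->
        `|r x - r y| <= - (C0 / ln (edist x y)) &
      exists r_oo C_oo : R, [/\ 0 < r_oo, 0 < C_oo &
        forall x, `|r x - r_oo| <= C_oo / ln (expR 1 + enorm x)]].

Local Open Scope ereal_scope.

(* t ^ q for t >= 0 and q in [1, +oo], with t ^ +oo equal to 0 if t <= 1 and to
   +oo otherwise; the value at q = -oo is irrelevant. *)
Definition epow (t q : \bar R) : \bar R :=
  match q with
  | s%:E => t `^ s
  | +oo => if t <= 1 then 0 else +oo
  | -oo => 0
  end.

Definition vnorm q f : \bar R :=
  ereal_inf [set l%:E | l in [set l : R |
    (0 < l)%R /\ \int[mu]_x epow `|f x * (l^-1)%:E| (q x) <= 1]].

Definition fint Q f : \bar R := (mu Q)^-1 * \int[mu]_(x in Q) f x.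

(* Product of elements of [0, +oo] in which +oo * 0 is +oo. *)
Definition mulY (a b : \bar R) : \bar R :=
  if (a == +oo) || (b == +oo) then +oo else a * b.

(* The inverse of an extended real, so that (w x)^-1 = +oo where w x = 0. *)
Definition inv_weight w : Rn -> \bar R := fun x => (w x)%:E^-1.

Definition scalar_weight w : Prop :=
  [/\ measurable_fun [set: Rn] w, forall x, (0 <= w x)%R &
      {ae mu, forall x, (0 < w x)%R}].

(* The integral of log (w^-1) over Q may be an undefined +oo - +oo only if w is
   not integrable on Q; the other factor is then +oo, and so is the mulY. *)
Definition log_factor w Q : \bar R :=
  expeR (fint Q (fun x => lne (inv_weight w x))).

Definition Ap p : set (Rn -> R) :=
  [set w | scalar_weight w /\
    ereal_sup [set (mu Q)^-1 *
        mulY (vnorm p ((EFin \o w) \_ Q))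
             (vnorm (conj_exponent p) ((inv_weight w) \_ Q))
      | Q in cube] < +oo].

Definition Apinfty p : set (Rn -> R) :=
  [set w | scalar_weight w /\
    ereal_sup [set (vnorm p ((cst 1) \_ Q))^-1 *
        mulY (vnorm p ((EFin \o w) \_ Q)) (log_factor w Q)
      | Q in cube] < +oo].

Definition Ainfty : set (Rn -> R) :=
  [set w | scalar_weight w /\
    ereal_sup [set mulY (fint Q (EFin \o w)) (log_factor w Q) | Q in cube]
      < +oo].

End variable_exponent.

(* Main.v *)
Require Import Defs.
From HB Require Import structures.
From mathcomp Require Import all_boot all_order all_algebra.
From mathcomp Require Import all_classical all_reals all_analysis.
From mathcomp Require Import measurable_realfun ess_sup_inf.
From mathcomp Require Import ring lra.

Set Implicit Arguments.
Unset Strict Implicit.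
Unset Printing Implicit Defensive.

(* Last, so that [coord] is the coordinate of a point and not of vector.v. *)
Import Defs.
Import Order.TTheory GRing.Theory Num.Def Num.Theory.
Import numFieldNormedType.Exports.

Local Open Scope classical_set_scope.
Local Open Scope ring_scope.

(** Both inclusions come from Hoelder's inequality for the Luxemburg norm,
    tested against the indicator of a cube ([hoelder_indic]).

    For the first one, Jensen's inequality bounds the exponential mean of [w^-1]
    over [Q] by the average of [w^-1], and Hoelder's inequality bounds that
    average by the dual norm of [w^-1] on [Q] times [|1_Q| / |Q|], where [|1_Q|]
    is the norm of the indicator in the exponent [p]. Dividing by [|1_Q|] leaves
    twice the quantity that defines the smaller class.

    For the second one, the average of [w] is at most twice the norm of [w] on
    [Q] times [|1_Q|' / |Q|], where [|1_Q|'] is the norm of the indicator in the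
    dual exponent, so one needs [|1_Q| |1_Q|' <= K |Q|]
    ([vnorm_indic_mul_conj]): the constant weight belongs to the smallest class.
    This is where the regularity of the exponent enters. On a small cube of
    measure [w] the local condition makes [|p x - p a| |ln w|] bounded, with [a]
    the lower corner, so that [|1_Q|] is [O(w ^ (1 / p a))]; the dual
    exponent gives [O(w ^ (1 / p' a))], and the two powers multiply to [w]. On a
    large cube the same argument works with the limit exponent at infinity,
    outside a box around the origin that is small enough to be harmless.

    Both strictness claims use powers [|x_0| ^ b] of a single coordinate. Their
    averages over a cube behave like their values at the largest [|x_0|] on the
    cube, because the slabs [|x_0| <= t max |x_0|] fill at most a fraction
    [4 t] of it ([slab_fraction]); summing over dyadic [t] controls the averages
    of [|x_0| ^ (- c)] for [c < 1] and of [ln |x_0|], uniformly in the cube.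
    - [|x_0| ^ 2] is locally bounded, which with the logarithmic estimate puts
      it in the middle class; its inverse is too singular to have a finite dual
      norm on the unit cube.
    - Let [s > 1] be a lower bound of the exponent and [1 / s < c < 1]. Then
      [|x_0| ^ (- c)] is in the largest class, but its norm on the unit cube is
      infinite because its power [s] is not integrable. *)

(** * Boxes and their Lebesgue measure *)

Section boxes.
Context {R : realType}.
Local Notation R1 := (measurableTypeR R).

(** The same box as [box] below, in the type that carries the Borel sets, where
    the product structure of the measure is visible. *)
Definition tbox n (I : 'I_n -> interval R) : set (n.-tuple R1) :=
  [set x | forall i, tnth x i \in I i].

Lemma measurable_tbox n (I : 'I_n -> interval R) : measurable (tbox I).
Proof.
rewrite (_ : tbox I = \bigcap_(i in [set: 'I_n]) (fun x => tnth x i) @^-1` [set` I i]).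
  apply: fin_bigcap_measurable => // i _.
  rewrite -[X in measurable X]setTI.
  apply: measurable_tnth => //; exact: measurable_itv.
by apply/seteqP; split=> x H i; [move=> _; exact: H|exact: (H i Logic.I)].
Qed.

Lemma borel_lebesgue_tbox n (a b : 'I_n -> R) (bl br : 'I_n -> bool) :
  (forall i, a i <= b i) ->
  borel_lebesgue n (tbox (fun i => Interval (BSide (bl i) (a i)) (BSide (br i) (b i))))
  = (\prod_i (b i - a i))%:E.
Proof.
elim: n a b bl br => [|n IH] a b bl br ab.
  rewrite /= big_ord0 diracE mem_set//.
  by move=> [].
rewrite /= /lebesgue_step /pushforward.
pose J := Interval (BSide (bl ord0) (a ord0)) (BSide (br ord0) (b ord0)).
set B := (X in _ @^-1` X).
rewrite (_ : _ @^-1` B = [set` J] `*` tbox (fun i => Interval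
  (BSide (bl (lift ord0 i)) (a (lift ord0 i)))
  (BSide (br (lift ord0 i)) (b (lift ord0 i))))); last first.
  apply/seteqP; split=> [[x t]|[x t] [/= Hx Ht]] /=.
    move=> H; split => /=; first by have := H ord0; rewrite tnth0.
    by move=> i; have := H (lift ord0 i); rewrite tnthS.
  move=> i; have [->|[j ->]] : i = ord0 \/ exists j, i = lift ord0 j.
  - by case: (unliftP ord0 i) => [j ->|->]; [right; exists j|left].
  - by rewrite tnth0.
  - by rewrite tnthS; exact: Ht.
rewrite product_measure1E; [|exact: measurable_itv|exact: measurable_tbox].
rewrite IH// big_ord_recl EFinM; congr (_ * _)%E.
transitivity (lebesgue_measure ([set` J] : set R)); [done|rewrite lebesgue_measure_itv /=].
case: ifPn => [//|]; rewrite lte_fin -leNgt => ba.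
by rewrite (_ : a ord0 = b ord0) ?subrr//; apply/eqP; rewrite eq_le ab ba.
Qed.

Definition box n (I : 'I_n -> interval R) : set (Rn R n) :=
  [set x : Rn R n | forall i, coord x i \in I i].

Lemma measurable_Rn n (A : set (n.-tuple R1)) :
  measurable A -> measurable (A : set (Rn R n)).
Proof. exact: (@caratheodory_measurable_mu_ext _ _ _ (borel_lebesgue n)). Qed.

Lemma measurable_box n (I : 'I_n -> interval R) : measurable (box I).
Proof. exact: measurable_Rn (measurable_tbox I). Qed.

Lemma lebesgue_Rn_box n (a b : 'I_n -> R) (bl br : 'I_n -> bool) :
  (forall i, a i <= b i) ->
  lebesgue_Rn (box (fun i => Interval (BSide (bl i) (a i)) (BSide (br i) (b i))))
  = (\prod_i (b i - a i))%:E.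
Proof.
move=> ab; rewrite -(borel_lebesgue_tbox bl br ab).
by rewrite /lebesgue_Rn/= /completed_measure_extension measurable_mu_extE//; exact: measurable_tbox.
Qed.

Lemma measurable_coord n (i : 'I_n) :
  measurable_fun [set: Rn R n] (fun x : Rn R n => coord x i).
Proof.
move=> _ Y mY; rewrite setTI.
apply: measurable_Rn; rewrite -[X in measurable X]setTI.
exact: measurable_tnth.
Qed.

End boxes.

(** * Integrals, powers and Jensen's inequality *)

Section integral_facts.
Local Open Scope ereal_scope.
Context d (T : measurableType d) (R : realType).
Variable mu : {measure set T -> \bar R}.

(** Neither measurability nor integrability is required, since the integrals of
    the positive and negative parts are suprema over simple functions below
    them and [+oo - +oo] is [-oo]. *)
Lemma le_integral_pointwise (D : set T) (f g : T -> \bar R) :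
  (forall x, D x -> f x <= g x) ->
  \int[mu]_(x in D) f x <= \int[mu]_(x in D) g x.
Proof.
move=> fg; rewrite /integral.
have fgD x : (f \_ D) x <= (g \_ D) x by apply: lee_restrict.
apply: leeB; apply: le_ereal_sup => _ [h hf <-]; exists h => //= x;
  apply: le_trans (hf x) _; rewrite ?funeposE ?funenegE ge_max !le_max ?leeN2.
  by rewrite fgD lexx orbT.
by rewrite fgD lexx orbT.
Qed.

Lemma ge0_le_integral_subset (D E : set T) (f : T -> \bar R) :
  D `<=` E -> (forall x, 0 <= f x) ->
  \int[mu]_(x in D) f x <= \int[mu]_(x in E) f x.
Proof.
move=> DE f0; rewrite (integral_mkcond D) (integral_mkcond E).
apply: le_integral_pointwise => x _; rewrite /patch.
case: ifPn => xD; first by rewrite mem_set//; apply: DE; exact/set_mem.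
by case: ifP.
Qed.

End integral_facts.

Section measurability.
Local Open Scope ereal_scope.
Context (R : realType).

Lemma measurable_expeR : measurable_fun [set: \bar R] (@expeR R).
Proof.
rewrite (_ : @expeR R = fun x => if x == +oo then +oo else
   if x == -oo then 0 else (expR (fine x))%:E); last by apply/funext => -[].
apply: measurable_fun_ifT => //=; first exact: measurable_fun_eqe.
apply: measurable_fun_ifT => //=; first exact: measurable_fun_eqe.
by apply/measurable_EFinP; apply: measurableT_comp.
Qed.

Lemma measurable_lne : measurable_fun [set: \bar R] (@lne R).
Proof.
rewrite (_ : @lne R = fun x => if x == +oo then +oo else
   if x <= 0 then -oo else (ln (fine x))%:E); last first.
  by apply/funext => -[] //=; rewrite ?leNye.
apply: measurable_fun_ifT => //=; first exact: measurable_fun_eqe.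
apply: measurable_fun_ifT => //=; first exact: measurable_fun_lee.
by apply/measurable_EFinP; apply: measurableT_comp.
Qed.

(** In this form the power is visibly monotone in the base and jointly
    measurable in base and exponent. *)
Lemma epowE (t : \bar R) (s : R) : (0 < s)%R -> 0 <= t ->
  epow t s%:E = expeR (s%:E * lne t).
Proof.
move=> s0; case: t => [t| |] //=; last first.
  by rewrite gt0_muley ?lte_fin//= gt_eqF.
rewrite lee_fin => t0; rewrite /powR; case: (eqVneq t 0%R) => [->|tn0].
  by rewrite lexx gt0_muleNy ?lte_fin//= gt_eqF.
by rewrite leNgt lt_neqAle eq_sym tn0 t0 /=.
Qed.

Lemma epow_ge0 (t q : \bar R) : 0 <= epow t q.
Proof.
case: q => [s| |]//=; last by case: ifP.
case: t => [t| |] /=; first by rewrite lee_fin powR_ge0.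
  by case: ifP.
by case: ifP.
Qed.

Lemma le_epow (t u : \bar R) (s : R) : (0 < s)%R -> 0 <= t -> t <= u ->
  epow t s%:E <= epow u s%:E.
Proof.
move=> s0 t0 tu; have u0 := le_trans t0 tu.
rewrite !epowE// lee_expeR lee_pmul2l ?lte_fin//.
by rewrite lee_lne// in_itv/= ?t0 ?u0 leey.
Qed.

Lemma measurable_epow d (T : measurableType d) (f : T -> \bar R) (q : T -> R) :
  measurable_fun setT f -> measurable_fun setT q -> (forall x, 0 < q x)%R ->
  (forall x, 0 <= f x) ->
  measurable_fun setT (fun x => epow (f x) (q x)%:E).
Proof.
move=> mf mq q0 f0.
under eq_fun do rewrite epowE//.
apply: (measurableT_comp measurable_expeR).
apply: emeasurable_funM; first exact/measurable_EFinP.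
exact: (measurableT_comp measurable_lne).
Qed.

(** Young's inequality; its weights [1/s] and [1/s'] are dropped, as constants
    uniform in the exponent are all that matters. *)
Lemma young_epow (a : \bar R) (b s s' : R) : (1 < s)%R -> (1 < s')%R ->
  (s^-1 + s'^-1 = 1)%R -> 0 <= a -> (0 <= b)%R ->
  a * b%:E <= epow a s%:E + epow b%:E s'%:E.
Proof.
move=> s1 s'1 ss' a0 b0.
have s0 : (0 < s)%R by apply: lt_trans s1.
have s'0 : (0 < s')%R by apply: lt_trans s'1.
case: a a0 => [a| _|//]; last first.
  by rewrite /= gt_eqF// addye ?leey// -ltNye ltNyr.
rewrite lee_fin => a0 /=; rewrite -EFinM -EFinD lee_fin.
apply: (le_trans (conjugate_powR a0 b0 s0 s'0 ss')).
by apply: lerD; rewrite ler_piMr ?powR_ge0// invf_le1// ltW.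
Qed.

End measurability.

Section jensen.
Local Open Scope ereal_scope.
Context (R : realType) (n : nat).
Local Notation mu := (@lebesgue_Rn R n).
Implicit Types (Q : set (Rn R n)) (f : Rn R n -> \bar R).

Lemma fint_le Q f g : (forall x, Q x -> f x <= g x) -> fint Q f <= fint Q g.
Proof.
move=> fg; rewrite /fint; apply: lee_wpmul2l; last exact: le_integral_pointwise.
by rewrite inve_ge0 measure_ge0.
Qed.

(** The hypotheses on [f] make it integrable, so that the signed constant [c]
    cannot meet an infinite integral. *)
Lemma fint_affine Q f (m c k : R) : measurable Q -> mu Q = m%:E -> (0 < m)%R ->
  measurable_fun Q f -> (forall x, Q x -> 0 <= f x) -> fint Q f < +oo -> (0 <= k)%R ->
  fint Q (fun x => c%:E + k%:E * f x) = c%:E + k%:E * fint Q f.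
Proof.
move=> mQ Qm m0 mf f0 foo k0.
have Em : (mu Q)^-1 = m^-1%:E by rewrite Qm inver gt_eqF.
have intf : mu.-integrable Q f.
  apply/integrableP; split => //.
  rewrite (eq_integral f); last by move=> x /[!inE] Qx; rewrite gee0_abs// f0.
  move: foo; rewrite /fint Em; set I := integral _ _ _.
  have : 0 <= I by exact: integral_ge0.
  by case: I => // [r _|_]; rewrite ?ltry// gt0_muley ?lte_fin ?invr_gt0.
have intc : mu.-integrable Q (cst c%:E).
  apply/integrableP; split; first exact: measurable_cst.
  by rewrite integral_cst//= Qm ltry.
rewrite /fint integralD//=; last exact: integrableZl.
rewrite integral_cst//= integralZl// Em Qm muleDr//.
congr (_ + _); last by rewrite muleCA.
by rewrite -!EFinM mulrCA mulVf ?mulr1// gt_eqF.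
Qed.

(** Jensen's inequality for the logarithm, from the tangent of [ln] at every
    level [c] above the average: such a level is positive even when the average
    is zero. *)
Lemma expeR_fint_lne_le Q f (m : R) : measurable Q -> mu Q = m%:E -> (0 < m)%R ->
  measurable_fun Q f -> (forall x, Q x -> 0 <= f x) ->
  expeR (fint Q (fun x => lne (f x))) <= fint Q f.
Proof.
move=> mQ Qm m0 mf f0.
have A0 : 0 <= fint Q f.
  by apply: mule_ge0; [rewrite inve_ge0 measure_ge0|exact: integral_ge0].
have [->|Aoo] := eqVneq (fint Q f) +oo; first by rewrite leey.
have Alt : fint Q f < +oo by rewrite ltey.
have [A AE] : exists A, fint Q f = A%:E.
  by exists (fine (fint Q f)); rewrite fineK// ge0_fin_numE.
have A0' : (0 <= A)%R by rewrite -lee_fin -AE.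
rewrite AE; apply/lee_addgt0Pr => e e0; rewrite -EFinD; set c := (A + e)%R.
have c0 : (0 < c)%R by rewrite ltr_wpDl.
rewrite -(@lnK _ c)// -[X in _ <= X]/(expeR (ln c)%:E) lee_expeR.
apply: (@le_trans _ _ (fint Q (fun x => (ln c - 1)%:E + c^-1%:E * f x))).
  apply: fint_le => x Qx /=; case: (f x) (f0 x Qx) => [t| _|//]; last first.
    by rewrite gt0_muley ?lte_fin ?invr_gt0.
  rewrite lee_fin => t0; rewrite -EFinM -EFinD /=; case: ifPn => [|]; first by rewrite leNye.
  rewrite -ltNge => t0'; rewrite lee_fin.
  have -> : (ln t = ln (t / c) + ln c)%R.
    by rewrite -lnM ?posrE ?divr_gt0// divfK// gt_eqF.
  have := @le_ln1Dx _ (t / c - 1)%R.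
  rewrite addrCA subrr addr0 ltrBrDr addNr divr_gt0// => /(_ isT).
  by rewrite (mulrC c^-1%R); lra.
rewrite (fint_affine _ mQ Qm m0)//; last by rewrite invr_ge0 ltW.
rewrite AE -EFinM -EFinD lee_fin.
have : (c^-1 * A <= 1)%R by rewrite mulrC ler_pdivrMr// mul1r /c lerDl ltW.
lra.
Qed.

End jensen.

(** * The Luxemburg norm and Hoelder's inequality *)

Section generic_hoelder.
Local Open Scope ereal_scope.
Context (R : realType).

Lemma ge0_neqy_EFin (x : \bar R) : 0 <= x -> x != +oo ->
  exists2 a : R, (0 <= a)%R & x = a%:E.
Proof. by case: x => [a| |]//; rewrite lee_fin => a0 _; exists a. Qed.

Context d (T : measurableType d) (mu : {measure set T -> \bar R}).

Lemma measurable_modular (Q : set T) (f : T -> \bar R) (q : T -> R) (c : R) :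
  measurable Q -> measurable_fun Q f -> measurable_fun setT q ->
  (forall x, 0 < q x)%R ->
  measurable_fun setT (fun x => epow `|(f \_ Q) x * c%:E| (q x)%:E).
Proof.
move=> mQ mf mq q0; apply: measurable_epow => //.
apply: (measurableT_comp (@abse_measurable _ setT)); apply: emeasurable_funM => //.
exact/(measurable_restrictT _ _).1.
Qed.

(** Integrate [young_epow] for [a = f x / l] and [b = 1 / h] over [Q]. *)
Lemma modular_hoelder (q q' : T -> R) (Q : set T) (f : T -> \bar R) (l h : R) :
  (forall x, 1 < q x)%R -> (forall x, 1 < q' x)%R ->
  measurable_fun setT q -> measurable_fun setT q' ->
  (forall x, ((q x)^-1 + (q' x)^-1 = 1)%R) ->
  measurable Q -> measurable_fun Q f -> (forall x, 0 <= f x) ->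
  (0 < l)%R -> (0 < h)%R ->
  \int[mu]_x epow `|(f \_ Q) x * (l^-1)%:E| (q x)%:E <= 1 ->
  \int[mu]_x epow `|(cst 1 \_ Q) x * (h^-1)%:E| (q' x)%:E <= 1 ->
  \int[mu]_(x in Q) f x <= (2 * (l * h))%:E.
Proof.
move=> q1 q'1 mq mq' qq' mQ mf f0 l0 h0 hl hh.
have q0 x : (0 < q x)%R by apply: lt_trans (q1 x).
have q'0 x : (0 < q' x)%R by apply: lt_trans (q'1 x).
pose F x := `|(f \_ Q) x * (l^-1)%:E|; pose G x := `|(cst 1 \_ Q) x * (h^-1)%:E|.
have mF : measurable_fun setT (fun x => epow (F x) (q x)%:E).
  exact: measurable_modular.
have mG : measurable_fun setT (fun x => epow (G x) (q' x)%:E).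
  by apply: measurable_modular => //; exact: measurable_cst.
apply: (@le_trans _ _ (\int[mu]_(x in Q) ((l * h)%:E *
    (epow (F x) (q x)%:E + epow (G x) (q' x)%:E)))).
  apply: le_integral_pointwise => x Qx.
  rewrite /F /G !patchE mem_set// mul1e.
  rewrite [X in epow X (q' x)%:E]gee0_abs; last by rewrite lee_fin invr_ge0 ltW.
  rewrite gee0_abs; last by rewrite mule_ge0// lee_fin invr_ge0 ltW.
  have a0 : 0 <= f x * (l^-1)%:E by rewrite mule_ge0// lee_fin invr_ge0 ltW.
  have h0' : (0 <= h^-1)%R by rewrite invr_ge0 ltW.
  have Y := young_epow (q1 x) (q'1 x) (qq' x) a0 h0'.
  apply: le_trans (lee_wpmul2l _ Y); last by rewrite lee_fin mulr_ge0 ?ltW.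
  rewrite -muleA -EFinM muleCA -EFinM.
  have -> : (l * h * (l^-1 * h^-1) = 1)%R by field; rewrite !gt_eqF.
  by rewrite mule1.
rewrite ge0_integralZl_EFin//; last 3 first.
- by move=> x _; rewrite adde_ge0// epow_ge0.
- by apply: emeasurable_funD; apply: measurable_funTS.
- by rewrite mulr_ge0 ?ltW.
rewrite ge0_integralD//; last 4 first.
- by move=> x _; rewrite epow_ge0.
- exact: measurable_funTS.
- by move=> x _; rewrite epow_ge0.
- exact: measurable_funTS.
rewrite (mulrC 2%R) (EFinM (l * h)); apply: lee_wpmul2l; first by rewrite lee_fin mulr_ge0 ?ltW.
rewrite (_ : 2 = 1 + 1)%R// EFinD; apply: leeD.
  apply: le_trans hl; apply: ge0_le_integral_subset => // x; exact: epow_ge0.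
apply: le_trans hh; apply: ge0_le_integral_subset => // x; exact: epow_ge0.
Qed.

End generic_hoelder.

Section luxemburg_norm.
Local Open Scope ereal_scope.
Context (R : realType) (n : nat).
Local Notation mu := (@lebesgue_Rn R n).
Implicit Types (Q : set (Rn R n)) (f : Rn R n -> \bar R) (q : Rn R n -> R).

Definition modular_le1 q f (l : R) : Prop :=
  (0 < l)%R /\ \int[mu]_x epow `|f x * (l^-1)%:E| (q x)%:E <= 1.

Lemma vnorm_le q f l : modular_le1 q f l -> vnorm (EFin \o q) f <= l%:E.
Proof. by move=> h; apply: ereal_inf_lbound; exists l. Qed.

Lemma vnorm_ge0 q f : 0 <= vnorm (EFin \o q) f.
Proof. by apply: le_ereal_inf_tmp => _ [l [l0 _] <-]; rewrite lee_fin ltW. Qed.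

Lemma lt_vnorm q f (x : \bar R) : vnorm (EFin \o q) f < x ->
  exists2 l, modular_le1 q f l & l%:E < x.
Proof. by move=> /ereal_inf_lt[_ [l hl <-] lx]; exists l. Qed.

Lemma vnorm_eqy q f : (forall l, ~ modular_le1 q f l) ->
  vnorm (EFin \o q) f = +oo.
Proof.
move=> h; apply/eqP; rewrite -leye_eq; apply: le_ereal_inf_tmp => _ [l hl <-].
by case: (h l).
Qed.

Lemma mulY_lty (a b : \bar R) : mulY a b < +oo ->
  [/\ a < +oo, b < +oo & mulY a b = a * b].
Proof.
rewrite /mulY; case: ifPn; first by rewrite ltxx.
by rewrite negb_or => /andP[a1 b1] _; rewrite !ltey.
Qed.

(** An upper bound by all products of admissible numbers passes to the product
    of the two infima; the convention [oo * 0 = oo] covers empty infima. *)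
Lemma le_mulY_vnorm q q' f g (x : \bar R) :
  (forall l h, modular_le1 q f l -> modular_le1 q' g h -> x <= (2 * (l * h))%:E) ->
  x <= 2%:E * mulY (vnorm (EFin \o q) f) (vnorm (EFin \o q') g).
Proof.
move=> H; rewrite /mulY; case: ifPn => [_|].
  by rewrite gt0_muley ?lte_fin// leey.
rewrite negb_or => /andP[foo goo].
have [a a0 aE] := ge0_neqy_EFin (vnorm_ge0 q f) foo.
have [b b0 bE] := ge0_neqy_EFin (vnorm_ge0 q' g) goo.
rewrite aE bE -!EFinM; apply/lee_addgt0Pr => e e0.
pose k : R := (2 * (a + b + 1))%R.
have k0 : (0 < k)%R by rewrite /k; lra.
(* For [d <= 1], [(a + d) * (b + d) <= a * b + d * (a + b + 1)]; doubled, the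
   excess is at most [d * k <= e]. *)
pose d := minr 1%R (e / k)%R.
have d0 : (0 < d)%R by rewrite lt_min ltr01 divr_gt0.
have d1 : (d <= 1)%R by rewrite ge_min lexx.
have dk : (d * k <= e)%R by rewrite -ler_pdivlMr// ge_min lexx orbT.
have [l hl la] : exists2 l, modular_le1 q f l & (l%:E < (a + d)%:E).
  by apply: lt_vnorm; rewrite aE lte_fin; lra.
have [h hh hb] : exists2 h, modular_le1 q' g h & (h%:E < (b + d)%:E).
  by apply: lt_vnorm; rewrite bE lte_fin; lra.
apply: (le_trans (H _ _ hl hh)); rewrite -EFinD lee_fin.
rewrite lte_fin in la; rewrite lte_fin in hb.
have l0 := hl.1; have h0 := hh.1.
have : (l * h <= (a + d) * (b + d))%R by apply: ler_pM; rewrite ltW.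
have : (d * d <= d)%R by rewrite ler_piMr// ltW.
have -> : ((a + d) * (b + d) = a * b + (d * (a + b) + d * d))%R by ring.
move: dk; rewrite /k; have -> : (d * (2 * (a + b + 1)) = 2 * (d * (a + b)) + 2 * d)%R by ring.
lra.
Qed.

Section hoelder.
Variables (q q' : Rn R n -> R).
Hypotheses (q1 : forall x, (1 < q x)%R) (q'1 : forall x, (1 < q' x)%R).
Hypotheses (mq : measurable_fun setT q) (mq' : measurable_fun setT q').
Hypothesis qq' : forall x, ((q x)^-1 + (q' x)^-1 = 1)%R.

Lemma hoelder_indic Q f : measurable Q -> measurable_fun Q f ->
  (forall x, 0 <= f x) ->
  \int[mu]_(x in Q) f x <=
    2%:E * mulY (vnorm (EFin \o q) (f \_ Q)) (vnorm (EFin \o q') (cst 1 \_ Q)).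
Proof.
move=> mQ mf f0; apply: le_mulY_vnorm => l h [l0 hl] [h0 hh].
exact: (modular_hoelder q1 q'1 mq mq' qq' mQ mf f0 l0 h0 hl hh).
Qed.

End hoelder.

Section indicators.
Variable q : Rn R n -> R.
Hypothesis q1 : forall x, (1 <= q x)%R.
Let q0 x : (0 < q x)%R. Proof. by apply: lt_le_trans (q1 x). Qed.

Lemma vnorm_indic_le Q l : (0 < l)%R ->
  \int[mu]_(x in Q) (l^-1 `^ q x)%:E <= 1 ->
  vnorm (EFin \o q) (cst 1 \_ Q) <= l%:E.
Proof.
move=> l0 h; apply: vnorm_le; split => //.
apply: le_trans h; rewrite (integral_mkcond Q).
apply: le_integral_pointwise => x _; rewrite /patch; case: ifP => xQ.
  by rewrite mul1e gee0_abs//= lee_fin invr_ge0 ltW.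
by rewrite mul0e abse0 /= powR0// gt_eqF.
Qed.

(** [maxr 1 (mu Q)] is admissible, because [q >= 1]. *)
Lemma vnorm_indic_lty Q : measurable Q -> mu Q < +oo ->
  vnorm (EFin \o q) (cst 1 \_ Q) < +oo.
Proof.
move=> mQ Qoo; pose l := maxr 1%R (fine (mu Q)).
have l1 : (1 <= l)%R by rewrite le_max lexx.
have l0 : (0 < l)%R by lra.
apply: (@le_lt_trans _ _ l%:E); last exact: ltry.
apply: vnorm_indic_le => //.
apply: (@le_trans _ _ (\int[mu]_(x in Q) (cst (l^-1)%:E x))).
  apply: le_integral_pointwise => x Qx; rewrite lee_fin.
  apply: ge1r_powR => //; rewrite invr_gt0 l0 /= invf_le1//.
rewrite integral_cst//= -(@fineK _ (mu Q)) ?ge0_fin_numE//.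
by rewrite -EFinM lee_fin mulrC ler_pdivrMr// mul1r le_max lexx orbT.
Qed.

Lemma vnorm_bounded_le Q f (M : R) : (0 < M)%R ->
  (forall x, Q x -> 0 <= f x <= M%:E) ->
  vnorm (EFin \o q) (f \_ Q) <= M%:E * vnorm (EFin \o q) (cst 1 \_ Q).
Proof.
move=> M0 fM; rewrite -lee_pdivrMl//.
apply: le_ereal_inf_tmp => _ [h [h0 hh] <-]; rewrite lee_pdivrMl// -EFinM.
apply: vnorm_le; split; first exact: mulr_gt0.
apply: le_trans hh; apply: le_integral_pointwise => x _.
apply: le_epow => //.
have Mh : (0 < M * h)%R by exact: mulr_gt0.
rewrite /patch; case: ifP => xQ; rewrite ?mul0e//.
have /andP[fx0 fx1] := fM x (set_mem xQ).
rewrite gee0_abs; last by rewrite mule_ge0// lee_fin invr_ge0 ltW.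
rewrite gee0_abs; last by rewrite mule_ge0// lee_fin invr_ge0 ltW.
apply: (@le_trans _ _ (M%:E * ((M * h)^-1)%:E)).
  by apply: lee_wpmul2r => //; rewrite lee_fin invr_ge0 ltW.
by rewrite mul1e -EFinM lee_fin invfM mulrA divff ?gt_eqF// mul1r.
Qed.

End indicators.

End luxemburg_norm.

(** * Norms of indicators of cubes *)

Section generic_step.
Context d (T : measurableType d) (R : realType) (mu : {measure set T -> \bar R}).

Lemma integral_step_le (Q B : set T) (a b : R) : 0 <= a -> 0 <= b ->
  measurable Q -> measurable B ->
  (\int[mu]_(x in Q) (a + b * \1_B x)%:E <= a%:E * mu Q + b%:E * mu B)%E.
Proof.
move=> a0 b0 mQ mB.
under eq_integral do rewrite EFinD EFinM.
have mI : measurable_fun Q (fun x => (\1_B x)%:E : \bar R).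
  by apply/measurable_EFinP; exact: measurable_indic.
rewrite ge0_integralD//; last 2 first.
- by move=> x _; rewrite -EFinM lee_fin mulr_ge0.
- exact: measurable_funeM.
rewrite integral_cst// ge0_integralZl_EFin//.
rewrite integral_indic//; apply: leeD => //.
by apply: lee_wpmul2l; rewrite ?lee_fin//; apply: le_measure; rewrite ?inE//; exact: measurableI.
Qed.

End generic_step.

Section cubes.
Context (R : realType) (n : nat).
Local Notation mu := (@lebesgue_Rn R n).
Implicit Types (Q : set (Rn R n)).

(** What the estimates use of a cube with lower corner [a] and edge [l], whichever
    of its faces it contains. *)
Definition in_cube (a : 'I_n -> R) (l : R) Q : Prop :=
  [/\ 0 < l, measurable Q, mu Q = (l ^+ n)%:E &
      forall x, Q x -> forall i, a i <= coord x i <= a i + l].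

Lemma in_cube_box (a : 'I_n -> R) (l : R) (bl br : 'I_n -> bool) : 0 < l ->
  in_cube a l
    (box (fun i => Interval (BSide (bl i) (a i)) (BSide (br i) (a i + l)))).
Proof.
move=> l0; split => //.
- exact: measurable_box.
- rewrite lebesgue_Rn_box; last by move=> i; rewrite lerDl ltW.
  congr (_%:E); under eq_bigr do rewrite addrAC subrr add0r.
  by rewrite prodr_const card_ord.
- move=> x /= Qx i; have := Qx i; rewrite itv_boundlr /= => /andP[h1 h2].
  apply/andP; split.
    by move: h1; case: (bl i); rewrite ?bnd_simp// => /ltW.
  by move: h2; case: (br i); rewrite ?bnd_simp// => /ltW.
Qed.

Lemma cube_in_cube Q : cube Q -> exists a l, in_cube a l Q.
Proof.
move=> [a [l [bl [br [l0 ->]]]]]; exists a, l; exact: in_cube_box.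
Qed.

Lemma le_coord_enorm (x : Rn R n) i : `|coord x i| <= enorm x.
Proof.
rewrite -sqrtr_sqr ler_sqrt.
  by rewrite (bigD1 i)//= lerDl sumr_ge0// => j _; exact: sqr_ge0.
by apply: sumr_ge0 => j _; exact: sqr_ge0.
Qed.

(** The dimensional factor [sqrt n] is absorbed by passing from [l] to [sqrt l],
    which only halves the logarithm. *)
Lemma edist_le (x y : Rn R n) (l : R) : 0 <= l -> n%:R * l <= 1 ->
  (forall i, `|coord x i - coord y i| <= l) -> edist x y <= Num.sqrt l.
Proof.
move=> l0 nl h; rewrite ler_sqrt//.
apply: (@le_trans _ _ (\sum_(i < n) l ^+ 2)).
  by apply: ler_sum => i _; rewrite -real_normK ?num_real// lerXn2r ?nnegrE.
rewrite sumr_const card_ord expr2 -mulr_natl mulrA.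
by rewrite ler_piMl.
Qed.

End cubes.

(** [w ^ (- t / q0)] is [w^-1] times [w ^ ((q0 - t) / q0)], and the logarithm of
    the last factor is at most [K]. *)
Lemma powR_close_exponent (R : realType) (w q0 t K : R) : 0 < w -> 1 <= q0 ->
  `|t - q0| * `|ln w| <= K -> w `^ (- q0^-1 * t) <= expR K * w^-1.
Proof.
move=> w0 q01 H; have q00 : 0 < q0 by lra.
have -> : w^-1 = expR (- ln w) by rewrite -lnV ?posrE// lnK ?posrE ?invr_gt0.
rewrite /powR gt_eqF// -expRD ler_expR.
have K0 : 0 <= K by apply: le_trans H; rewrite mulr_ge0.
have h : (q0 - t) * ln w <= K.
  by apply: le_trans H; rewrite distrC -normrM; exact: ler_norm.
have h2 : q0^-1 * ((q0 - t) * ln w) <= K.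
  have [c0|c0] := leP 0 ((q0 - t) * ln w).
    by apply: le_trans h; rewrite ler_piMl// invf_le1.
  by apply: le_trans K0; rewrite mulr_ge0_le0// ?invr_ge0 ltW.
have : q0^-1 * ((q0 - t) * ln w) = ln w - q0^-1 * t * ln w.
  by rewrite mulrA mulrBr mulVf ?gt_eqF// mulrBl mul1r.
by move: h2; rewrite !mulNr; lra.
Qed.

Section indicator_norms.
Context (R : realType) (n : nat).
Local Notation mu := (@lebesgue_Rn R n).
Implicit Types (Q : set (Rn R n)).
Variables (q : Rn R n -> R).
Hypothesis q1 : forall x, 1 <= q x.

Lemma powR_inv_scaled_le (A w q0 : R) x : 1 <= A ->
  (A * w `^ q0^-1)^-1 `^ q x <= A^-1 * w `^ (- q0^-1 * q x).
Proof.
move=> A1; have A0 : 0 < A by lra.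
rewrite invfM powRM ?invr_ge0 ?powR_ge0 ?(ltW A0)// -powRN -powRrM.
apply: ler_wpM2r; first exact: powR_ge0.
by apply: ge1r_powR => //; rewrite invr_gt0 A0 invf_le1.
Qed.

(** At [l = expR K * w ^ (1 / q0)] the integrand of the modular is at most [w^-1],
    by [powR_close_exponent]. *)
Lemma vnorm_indic_near_constant Q (w q0 K : R) : 0 < w -> 1 <= q0 -> 0 <= K ->
  measurable Q -> mu Q = w%:E ->
  (forall x, Q x -> `|q x - q0| * `|ln w| <= K) ->
  (vnorm (EFin \o q) (cst 1%E \_ Q) <= (expR K * w `^ q0^-1)%:E)%E.
Proof.
move=> w0 q01 K0 mQ Qw H.
have eK1 : 1 <= expR K by rewrite -expR0 ler_expR.
apply: vnorm_indic_le => //; first by rewrite mulr_gt0 ?expR_gt0 ?powR_gt0.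
apply: (@le_trans _ _ (\int[mu]_(x in Q) (cst (w^-1)%:E x))%E); last first.
  by rewrite integral_cst//= Qw -EFinM mulVf ?gt_eqF.
apply: le_integral_pointwise => x Qx; rewrite lee_fin /=.
apply: (le_trans (powR_inv_scaled_le _ _ _ eK1)).
by rewrite ler_pdivrMl ?expR_gt0//; apply: powR_close_exponent => //; exact: H.
Qed.

(** Outside a box [B] around the origin, [|q x - q0| * ln w] is bounded by the
    decay of [q - q0]. The box has sides [2 * w ^ (1 / (n * q0))], so that the
    bound [w ^ (- q x / q0) <= w ^ (- 1 / q0)], which only uses [q >= 1], makes
    its contribution at most [2 ^ n]. *)
Lemma vnorm_indic_large Q (w q0 C : R) : (0 < n)%N -> 1 <= w -> 1 <= q0 -> 0 < C ->
  measurable Q -> mu Q = w%:E ->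
  (forall x, `|q x - q0| <= C / ln (expR 1 + enorm x)) ->
  (vnorm (EFin \o q) (cst 1%E \_ Q) <=
     ((expR (C * n%:R * q0) + 2 ^+ n) * w `^ q0^-1)%:E)%E.
Proof.
move=> n0 w1 q01 C0 mQ Qw H.
have w0 : 0 < w by lra.
have q00 : 0 < q0 by lra.
have nR : 0 < n%:R :> R by rewrite ltr0n.
set K := C * n%:R * q0; set A := expR K + 2 ^+ n.
have A1 : 1 <= A.
  have : 1 <= 2 ^+ n :> R by rewrite exprn_ege1// ler1n.
  by have := expR_gt0 K; rewrite /A; lra.
have A0 : 0 < A by lra.
pose rho := w `^ (n%:R * q0)^-1.
have rho0 : 0 < rho by rewrite powR_gt0.
pose B : set (Rn R n) := box (fun i => Interval (BSide true (- rho)) (BSide false rho)).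
have mB : measurable B by exact: measurable_box.
have muB : mu B = (2 ^+ n * w `^ q0^-1)%:E.
  rewrite lebesgue_Rn_box; last by move=> i; lra.
  congr (_%:E); rewrite prodr_const card_ord opprK -mulr2n -(mulr_natl rho) exprMn.
  congr (_ * _); rewrite -powR_mulrn ?powR_ge0// -powRrM; congr (_ `^ _).
  by rewrite invfM mulrAC mulVf ?mul1r// gt_eqF.
have far x : ~ B x -> `|q x - q0| * `|ln w| <= K.
  rewrite (ger0_norm (ln_ge0 w1)).
  move=> Bx; have [i xi] : exists i, rho < `|coord x i|.
    apply: contrapT => /forallNP xB; apply: Bx => i /=.
    by rewrite itv_boundlr/= !bnd_simp -ler_norml leNgt; apply/negP.
  have lnr : ln w = n%:R * q0 * ln rho.
    by rewrite ln_powR mulrA mulfV ?mul1r// mulf_neq0 ?gt_eqF.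
  have e1 : 1 < expR 1 :> R by rewrite expR_gt1.
  have xn := le_coord_enorm x i.
  have Lr : ln rho <= ln (expR 1 + enorm x).
    rewrite ler_ln ?posrE//; last by have := normr_ge0 (coord x i); lra.
    by lra.
  have L0 : 0 < ln (expR 1 + enorm x).
    by apply: ln_gt0; have := normr_ge0 (coord x i); lra.
  apply: (@le_trans _ _ (C / ln (expR 1 + enorm x) * ln w)).
    by rewrite ler_wpM2r// ln_ge0.
  rewrite mulrAC ler_pdivrMr// /K lnr.
  by rewrite -!mulrA ler_wpM2l ?(ltW C0)// ler_wpM2l ?ler0n// ler_wpM2l// ltW.
apply: vnorm_indic_le => //; first by rewrite mulr_gt0 ?powR_gt0.
have l0 : 0 < A * w `^ q0^-1 by rewrite mulr_gt0 ?powR_gt0.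
set b := w `^ (- q0^-1).
have b0 : 0 <= b by exact: powR_ge0.
pose a := expR K * w^-1.
have a0 : 0 <= a by rewrite mulr_ge0 ?expR_ge0// invr_ge0 ltW.
have iA0 : 0 <= A^-1 by rewrite invr_ge0 ltW.
apply: (@le_trans _ _ (\int[mu]_(x in Q) (A^-1 * a + A^-1 * b * \1_B x)%:E)%E).
  apply: le_integral_pointwise => x Qx.
  rewrite lee_fin -mulrA -mulrDr; apply: (le_trans (powR_inv_scaled_le _ _ _ A1)).
  apply: ler_wpM2l => //; rewrite /indic; case: (pselect (B x)) => Bx.
    rewrite mem_set//= mulr1.
    apply: (@le_trans _ _ b); last by rewrite lerDr.
    by apply: ler_powR => //; rewrite mulNr lerN2 ler_peMr// ?invr_ge0 ltW.
  rewrite memNset//= mulr0 addr0; exact: powR_close_exponent (far x Bx).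
apply: le_trans (integral_step_le _ _ _ _ _) _; rewrite ?mulr_ge0 ?invr_ge0 ?(ltW w0) ?(ltW A0)//=.
rewrite Qw muB -!EFinM -EFinD lee_fin.
have -> : A^-1 * a * w = A^-1 * expR K by rewrite /a; field; rewrite !gt_eqF.
have -> : A^-1 * b * (2 ^+ n * w `^ q0^-1) = A^-1 * 2 ^+ n.
  rewrite -mulrA [b * _]mulrCA /b -powRD; last by apply/implyP => _; rewrite gt_eqF.
  by rewrite addNr powRr0 mulr1.
by rewrite -mulrDr mulVf// gt_eqF.
Qed.

End indicator_norms.

(** * Logarithmically Hoelder continuous exponents *)

Section log_hoelder_exponents.
Context (R : realType) (n : nat) (n_gt0 : (0 < n)%N).
Local Notation mu := (@lebesgue_Rn R n).
Implicit Types (Q : set (Rn R n)) (q : Rn R n -> R).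

Definition locally_lh q (C : R) : Prop :=
  forall x y, edist x y < 2^-1 -> `|q x - q y| <= - (C / ln (edist x y)).

Definition lh_at_infinity q (q_oo C : R) : Prop :=
  forall x, `|q x - q_oo| <= C / ln (expR 1 + enorm x).

Definition point (a : 'I_n -> R) : Rn R n := [tuple a i | i < n].

Lemma coord_point a i : coord (point a) i = a i.
Proof. exact: tnth_mktuple. Qed.

(** Points whose coordinates differ by at most [l] are at distance at most
    [sqrt l], so the modulus of continuity at [sqrt l] applies. *)
Lemma locally_lh_oscillation q C x y (l : R) : 0 <= C -> locally_lh q C ->
  0 < l -> l < (4 * n%:R)^-1 -> (forall i, `|coord x i - coord y i| <= l) ->
  `|q x - q y| * `|ln l| <= 2 * C.
Proof.
move=> C0 hq l0 ln4 xy.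
have n1 : 1 <= n%:R :> R by rewrite ler1n.
have nl : 4 * (n%:R * l) < 1.
  by move: ln4; rewrite -[X in l < X]div1r ltr_pdivlMr; [lra|lra].
have l4 : 4 * l < 1.
  by apply: le_lt_trans nl; rewrite ler_pM2l// ler_peMl// ltW.
have ed : edist x y <= Num.sqrt l by apply: edist_le => //; lra.
have sl : Num.sqrt l < 2^-1.
  have -> : 2^-1 = Num.sqrt (2^-1 ^+ 2) :> R by rewrite sqrtr_sqr ger0_norm.
  by rewrite ltr_sqrt//; lra.
have lnl : ln l < 0 by rewrite ln_lt0// l0; lra.
have h := hq x y (le_lt_trans ed sl).
(* At distance zero the hypothesis reads [|q x - q y| <= 0]. *)
have [ed0|ed0] := eqVneq (edist x y) 0.
  move: h; rewrite ed0 ln0// invr0 mulr0 oppr0 normr_le0 => /eqP ->.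
  by rewrite normr0 mul0r; lra.
have edp : 0 < edist x y by rewrite lt_neqAle eq_sym ed0 sqrtr_ge0.
have lned : ln (edist x y) <= 2^-1 * ln l.
  have -> : 2^-1 * ln l = ln (Num.sqrt l) by rewrite -powR12_sqrt ?ltW// ln_powR.
  by rewrite ler_ln ?posrE// sqrtr_gt0.
have lned0 : ln (edist x y) < 0 by lra.
rewrite (ltr0_norm lnl); apply: (le_trans (ler_wpM2r _ h)); first by lra.
have -> : - (C / ln (edist x y)) * - ln l = C * (ln l / ln (edist x y)).
  by rewrite mulrNN mulrAC mulrA.
rewrite (mulrC 2); apply: ler_wpM2l => //.
by rewrite ler_ndivrMr//; lra.
Qed.

(** Three regimes: below the edge [1 / (4 n)] the local condition compares [q]
    with its value at the lower corner, from [1] on the condition at infinity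
    compares it with its limit, and in between the norm is merely bounded. *)
Lemma vnorm_indic_cube q (q0 : R) C C' : (forall x, 1 <= q x) -> 1 <= q0 ->
  0 <= C -> 0 < C' -> locally_lh q C -> lh_at_infinity q q0 C' ->
  exists2 K, 0 < K & forall a l Q, in_cube a l Q ->
    [/\ l < (4 * n%:R)^-1 -> (vnorm (EFin \o q) (cst 1%E \_ Q) <=
          (K * (l ^+ n) `^ (q (point a))^-1)%:E)%E,
        l <= 1 -> (vnorm (EFin \o q) (cst 1%E \_ Q) <= 1)%E &
        1 <= l -> (vnorm (EFin \o q) (cst 1%E \_ Q) <=
          (K * (l ^+ n) `^ q0^-1)%:E)%E ].
Proof.
move=> q1 q01 C0 C'0 hloc hinf.
pose K1 := expR (n%:R * (2 * C)); pose K2 := expR (C' * n%:R * q0) + 2 ^+ n.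
have K10 : 0 < K1 := expR_gt0 _.
have K20 : 0 < K2 by rewrite addr_gt0 ?expR_gt0// exprn_gt0.
exists (K1 + K2); first exact: addr_gt0.
move=> a l Q [l0 mQ Qm Qa]; have ln0 : 0 < l ^+ n by rewrite exprn_gt0.
split.
- move=> ls; apply: (@le_trans _ _ (K1 * (l ^+ n) `^ (q (point a))^-1)%:E).
    apply: vnorm_indic_near_constant => //.
      by rewrite mulr_ge0 ?ler0n ?mulr_ge0.
    move=> x Qx.
    rewrite lnXn// -(mulr_natl (ln l)) normrM ger0_norm// mulrCA.
    apply: ler_wpM2l; first by rewrite ler0n.
    apply: locally_lh_oscillation => // i; rewrite coord_point.
    have /andP[h1 h2] := Qa x Qx i.
    by rewrite ger0_norm; lra.
  by rewrite lee_fin ler_wpM2r ?powR_ge0//; lra.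
- move=> l1; apply: vnorm_indic_le => //.
  apply: (@le_trans _ _ (\int[mu]_(x in Q) (cst 1 x))%E).
    by apply: le_integral_pointwise => x Qx; rewrite invr1 powR1.
  by rewrite integral_cst//= Qm mul1e lee_fin exprn_ile1// ltW.
- move=> l1; apply: (@le_trans _ _ (K2 * (l ^+ n) `^ q0^-1)%:E).
    by apply: vnorm_indic_large => //; rewrite exprn_ege1.
  by rewrite lee_fin ler_wpM2r ?powR_ge0//; lra.
Qed.

Definition conjr q : Rn R n -> R := fun x => q x / (q x - 1).

(** The dual exponent is a Lipschitz function of the exponent as long as the
    latter stays away from [1], so it inherits both logarithmic conditions. *)
Lemma conjr_dist (s a b : R) : 1 < s -> s <= a -> s <= b ->
  `|a / (a - 1) - b / (b - 1)| <= (s - 1) ^- 2 * `|a - b|.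
Proof.
move=> s1 sa sb.
have -> : a / (a - 1) - b / (b - 1) = ((a - 1) * (b - 1))^-1 * (b - a).
  by field; apply/andP; split; lra.
rewrite normrM distrC ler_wpM2r// ger0_norm; last first.
  by rewrite invr_ge0 mulr_ge0//; lra.
rewrite lef_pV2 ?posrE ?exprn_gt0 ?mulr_gt0 ?expr2//; try lra.
by apply: ler_pM; lra.
Qed.

Lemma conjr_gt1 (a : R) : 1 < a -> 1 < a / (a - 1).
Proof. by move=> a1; rewrite ltr_pdivlMr; lra. Qed.

Lemma conjrV (a : R) : 1 < a -> a^-1 + (a / (a - 1))^-1 = 1.
Proof. by move=> a1; field; apply/andP; split; lra. Qed.

(** In each regime of [vnorm_indic_cube] the two norms are bounded by powers of
    the measure whose exponents are dual to each other; cubes of intermediate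
    size have measure bounded below, which costs the constant [(4 n) ^ n]. *)
Lemma vnorm_indic_mul_conj q (q0 : R) C C' s : 1 < s -> (forall x, s <= q x) -> s <= q0 ->
  0 <= C -> 0 < C' -> locally_lh q C -> lh_at_infinity q q0 C' ->
  exists2 K, 0 < K & forall Q, cube Q ->
    (vnorm (EFin \o q) (cst 1%E \_ Q) * vnorm (EFin \o conjr q) (cst 1%E \_ Q)
       <= K%:E * mu Q)%E.
Proof.
move=> s1 sq sq0 C0 C'0 hloc hinf.
have d0 : 0 < (s - 1) ^- 2 by rewrite invr_gt0 exprn_gt0//; lra.
have [||||K K0 HK] := @vnorm_indic_cube q q0 C C' _ _ _ _ hloc hinf => //.
- by move=> x; have := sq x; lra.
- by lra.
have [||||||K' K'0 HK'] := @vnorm_indic_cube (conjr q) (q0 / (q0 - 1))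
    ((s - 1) ^- 2 * C) ((s - 1) ^- 2 * C').
- by move=> x; apply/ltW/conjr_gt1; have := sq x; lra.
- by apply/ltW/conjr_gt1; lra.
- by rewrite mulr_ge0// ltW.
- exact: mulr_gt0.
- move=> x y xy; apply: (le_trans (conjr_dist s1 (sq x) (sq y))).
  by rewrite -mulrA -mulrN ler_wpM2l ?(ltW d0)// hloc.
- move=> x; apply: (le_trans (conjr_dist s1 (sq x) sq0)).
  by rewrite -mulrA ler_wpM2l ?(ltW d0)// hinf.
have nR : 1 <= n%:R :> R by rewrite ler1n.
pose K'' := (4 * n%:R) ^+ n : R.
have K''0 : 0 < K'' by rewrite exprn_gt0//; lra.
exists (K * K' + K''); first by rewrite addr_gt0// mulr_gt0.
move=> Q /cube_in_cube[a [l aQ]].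
have [h1 h2 h3] := HK _ _ _ aQ; have [g1 g2 g3] := HK' _ _ _ aQ.
have [l0 mQ Qm _] := aQ.
have w0 : 0 < l ^+ n by rewrite exprn_gt0.
have pw (t : R) : 1 < t ->
  K * (l ^+ n) `^ t^-1 * (K' * (l ^+ n) `^ (t / (t - 1))^-1) = K * K' * l ^+ n.
  move=> t1; rewrite mulrACA -powRD; last by apply/implyP => _; rewrite gt_eqF.
  by rewrite conjrV// powRr1// ltW.
rewrite Qm -EFinM mulrDl EFinD.
have [ls|ls] := ltP l (4 * n%:R)^-1.
  apply: (@le_trans _ _ (K * K' * l ^+ n)%:E); last first.
    by rewrite leeDl// lee_fin mulr_ge0// ltW.
  rewrite -(pw (q (point a))); last by have := sq (point a); lra.
  rewrite EFinM; apply: lee_pmul; rewrite ?vnorm_ge0 ?h1 ?g1//.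
have [l1|l1] := leP l 1.
  apply: (@le_trans _ _ (K'' * l ^+ n)%:E); last first.
    by rewrite leeDr// lee_fin !mulr_ge0// ltW.
  apply: (@le_trans _ _ (1 * 1)%E).
    by apply: lee_pmul; rewrite ?vnorm_ge0 ?h2 ?g2//.
  rewrite mul1e lee_fin /K'' -exprMn exprn_ege1//.
  by move: ls; rewrite -[X in X <= l]div1r ler_pdivrMr; [rewrite mulrC|lra].
apply: (@le_trans _ _ (K * K' * l ^+ n)%:E); last first.
  by rewrite leeDl// lee_fin mulr_ge0// ltW.
rewrite -(pw q0); last by lra.
rewrite EFinM; apply: lee_pmul; rewrite ?vnorm_ge0 ?h3 ?g3// ltW//.
Qed.

(** Compare [q] with its limit at the points [(expR t, ..., expR t)]. *)
Lemma lh_limit_ge q (q0 : R) C s : 0 < C -> (forall x, s <= q x) ->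
  lh_at_infinity q q0 C -> s <= q0.
Proof.
move=> C0 sq H; rewrite leNgt; apply/negP => q0s.
pose t := 2 * C / (s - q0).
have t0 : 0 < t by rewrite divr_gt0//; lra.
pose x := point (fun=> expR t).
have xn : expR t <= enorm x.
  have := le_coord_enorm x (Ordinal n_gt0); rewrite coord_point.
  by rewrite ger0_norm// expR_ge0.
have L : t <= ln (expR 1 + enorm x).
  rewrite -ler_expR lnK ?posrE; first by have := expR_gt0 (1 : R); lra.
  by have := expR_gt0 (1 : R); have := expR_gt0 t; lra.
have : s - q0 <= C / t.
  apply: (@le_trans _ _ `|q x - q0|); first by rewrite ler_normr; have := sq x; lra.
  apply: (le_trans (H x)); apply: ler_wpM2l; first by rewrite ltW.
  by rewrite lef_pV2 ?posrE//; lra.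
have -> : C / t = (s - q0) / 2 by rewrite /t; field; apply/andP; split; lra.
lra.
Qed.

(** An exponent with a logarithmic modulus of continuity is continuous, so a
    bound valid almost everywhere is valid at every point. *)
Lemma locally_lh_ae_ge q C s : 0 <= C -> locally_lh q C ->
  {ae mu, forall x, s <= q x} -> forall x, s <= q x.
Proof.
move=> C0 hq [N [mN N0 sN]] x; rewrite leNgt; apply/negP => qs.
have nR : 1 <= n%:R :> R by rewrite ler1n.
(* [t] is such that a cube of edge [expR (- t)] at [x] is small enough for
   [locally_lh_oscillation] and [q] oscillates by less than [s - q x] on it. *)
pose t := 4 * n%:R + (2 * C + 1) / (s - q x).
have f0 : 0 < (2 * C + 1) / (s - q x) by rewrite divr_gt0//; lra.
have t0 : 0 < t by rewrite /t; lra.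
pose l := expR (- t).
have l0 : 0 < l := expR_gt0 _.
have l4 : l < (4 * n%:R)^-1.
  rewrite /l expRN ltf_pV2 ?posrE ?expR_gt0//; last lra.
  by have := expR_ge1Dx t; rewrite /t; lra.
pose B : set (Rn R n) := box (fun i =>
  Interval (BSide true (coord x i)) (BSide false (coord x i + l))).
have [_ mB muB _] : in_cube (coord x) l B by exact: in_cube_box.
have BN : B `<=` N.
  move=> y By; apply: sN => /= sy.
  have := @locally_lh_oscillation q C x y l C0 hq l0 l4.
  rewrite expRK normrN (gtr0_norm t0) => H.
  have : `|q x - q y| * t <= 2 * C.
    apply: H => i; have := By i; rewrite itv_boundlr/= !bnd_simp => /andP[h1 h2].
    by rewrite distrC ger0_norm; lra.
  have : s - q x <= `|q x - q y| by rewrite ler_normr; apply/orP; right; lra.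
  move=> /(ler_wpM2r (ltW t0)) h1 h2; have := le_trans h1 h2.
  have -> : (s - q x) * t = (s - q x) * (4 * n%:R) + (2 * C + 1).
    by rewrite /t; field; lra.
  have : 0 <= (s - q x) * (4 * n%:R) by rewrite mulr_ge0//; lra.
  lra.
have : (mu B <= mu N)%E by apply: le_measure; rewrite ?inE.
by rewrite N0 muB lee_fin leNgt exprn_gt0.
Qed.

End log_hoelder_exponents.

(** * Functions with thin sublevel sets *)

Lemma measurable_norm d (T : measurableType d) (R : realType) (f : T -> R) :
  measurable_fun setT f -> measurable_fun setT (fun x => `|f x|).
Proof. by move=> mf; apply: measurableT_comp. Qed.

Section sublevel_decay.
Context d (T : measurableType d) (R : realType) (mu : {measure set T -> \bar R}).
Variable u : T -> R.
Hypothesis mu_u : measurable_fun setT u.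

Definition sublevel (t : R) : set T := [set x | u x <= t].

Lemma measurable_sublevel t : measurable (sublevel t).
Proof.
rewrite -[X in measurable X]setTI; exact: (measurable_fun_le measurableT mu_u).
Qed.

Variables (c : R) (c0 : 0 < c) (c1 : c < 1).

Let r := 2 `^ c : R.

Let r1 : 1 < r.
Proof.
by rewrite /r /powR pnatr_eq0/= expR_gt1 mulr_gt0// ln_gt0// ltr1n.
Qed.

Let r2 : r < 2.
Proof.
rewrite -[X in _ < X](@powRr1 _ 2)// /r /powR !pnatr_eq0/= ltr_expR ltr_pM2r//.
by rewrite ln_gt0// ltr1n.
Qed.

Let r0 : 0 < r. Proof. exact: lt_trans r1. Qed.

(** A majorant of [(M / u x) `^ c] on [u <= M] which is infinite where [u] is
    zero and whose integrals are weighted sums of measures of sublevel sets. *)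
Definition dyadic (M : R) (x : T) : \bar R :=
  (\sum_(k <oo) (r ^+ k.+1 * \1_(sublevel (2 ^- k * M)) x)%:E)%E.

Let term_ge0 M k x : (0 <= (r ^+ k.+1 * \1_(sublevel (2 ^- k * M)) x)%:E)%E.
Proof. by rewrite lee_fin mulr_ge0// exprn_ge0// ltW. Qed.

Lemma dyadic_ge0 M x : (0 <= dyadic M x)%E.
Proof. by apply: nneseries_ge0 => k _ _; exact: term_ge0. Qed.

Let measurable_term M k D :
  measurable_fun D (fun x => (r ^+ k.+1 * \1_(sublevel (2 ^- k * M)) x)%:E).
Proof.
apply: measurable_funTS; apply/measurable_EFinP; apply: measurable_funM => //.
by apply: measurable_indic; exact: measurable_sublevel.
Qed.

Lemma measurable_dyadic M D : measurable_fun D (dyadic M).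
Proof.
apply: measurable_funTS; apply: ge0_emeasurable_sum => [k x _ _|k _].
  exact: term_ge0.
exact: measurable_term.
Qed.

Lemma dyadic_ge_term M k x : u x <= 2 ^- k * M ->
  ((r ^+ k.+1)%:E <= dyadic M x)%E.
Proof.
move=> xk.
apply: le_trans (@nneseries_lim_ge _ _ xpredT 0 k.+1 (fun j _ _ => term_ge0 M j x)).
rewrite big_nat_recr//= [X in (_ + X)%E](_ : _ = (r ^+ k.+1)%:E).
  by rewrite leeDr// sume_ge0.
by rewrite indicE mem_set// mulr1.
Qed.

(** All indicators in the series are one, and its coefficients are unbounded. *)
Lemma dyadic_eqy M x : 0 <= M -> u x <= 0 -> dyadic M x = +oo%E.
Proof.
move=> M0 x0; apply/eqP; rewrite -leye_eq leNgt; apply/negP => Goo.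
have [g g0 gE] := ge0_neqy_EFin (dyadic_ge0 M x) (negbT (lt_eqF Goo)).
have rk k : r ^+ k.+1 <= g.
  rewrite -lee_fin -gE; apply: dyadic_ge_term.
  by apply: (le_trans x0); rewrite mulr_ge0// invr_ge0 exprn_ge0.
have lnr : 0 < ln r by rewrite ln_gt0.
have g1 : 0 < g by apply: lt_le_trans (rk 0%N).
have := rk (truncn (ln g / ln r)).
rewrite -ler_ln ?posrE ?exprn_gt0// lnXn//.
rewrite -(mulr_natl (ln r)) -ler_pdivlMr// leNgt => /negP; apply.
exact: truncnS_gt.
Qed.

Lemma dyadic_ge_powR M x : 0 < u x -> u x <= M ->
  (((M / u x) `^ c)%:E <= dyadic M x)%E.
Proof.
move=> x0 xM; have M0 : 0 < M by lra.
(* The first such [k] is positive, and its predecessor is the last index whose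
   sublevel set contains [x]. *)
have exk : exists k, 2 ^- k * M < u x.
  exists (truncn (M / u x)).+1; rewrite mulrC ltr_pdivrMr ?exprn_gt0//.
  rewrite mulrC -ltr_pdivrMr//.
  apply: (lt_trans (truncnS_gt _)).
  by rewrite -natrX ltr_nat ltn_expl.
have [k mk kmin] := ex_minnP exk.
case: k mk kmin => [|k] mk kmin.
  by move: mk; rewrite expr0 invr1 mul1r ltNge xM.
have xk : u x <= 2 ^- k * M.
  by rewrite leNgt; apply/negP => /kmin; rewrite ltnn.
apply: le_trans (dyadic_ge_term xk); rewrite lee_fin /r.
rewrite -powR_mulrn ?powR_ge0// -powRrM (mulrC c) powRrM powR_mulrn//.
rewrite ge0_ler_powR ?nnegrE ?(ltW c0)//.
- by rewrite divr_ge0// ltW.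
- rewrite ler_pdivrMr// ltW//.
  by move: mk; rewrite mulrC ltr_pdivrMr ?exprn_gt0// mulrC.
Qed.

(** The sum of the geometric series in [integral_dyadic_le]. *)
Definition dyadic_mass : R := 4 * r * (1 - r / 2)^-1.

(** The measures of the sublevel sets decay like [2 ^- k] and the coefficients
    grow like [r ^+ k] with [r < 2], so the integrals form a geometric series. *)
Lemma integral_dyadic_le Q (M m : R) : measurable Q -> 0 <= m ->
  (forall t, 0 <= t -> (mu (Q `&` sublevel (t * M)) <= (4 * t * m)%:E)%E) ->
  (\int[mu]_(x in Q) dyadic M x <= (dyadic_mass * m)%:E)%E.
Proof.
move=> mQ m0 H; rewrite /dyadic integral_nneseries//.
apply: lime_le; first by apply: is_cvg_nneseries => k _ _; exact: integral_ge0.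
apply: nearW => N.
apply: (@le_trans _ _ (\sum_(0 <= k < N) (4 * r * m * (r / 2) ^+ k)%:E)%E).
  apply: lee_sum => k _.
  under eq_integral do rewrite EFinM.
  rewrite ge0_integralZl_EFin//; last 2 first.
  - by apply/measurable_EFinP; apply: measurable_indic; exact: measurable_sublevel.
  - by rewrite exprn_ge0// ltW.
  rewrite integral_indic//; last exact: measurable_sublevel.
  rewrite setIC.
  apply: (@le_trans _ _ ((r ^+ k.+1)%:E * (4 * 2 ^- k * m)%:E)%E).
    apply: lee_wpmul2l; first by rewrite lee_fin exprn_ge0// ltW.
    by apply: H; rewrite invr_ge0 exprn_ge0.
  by rewrite -EFinM lee_fin exprMn exprVn exprS le_eqVlt; apply/orP; left; apply/eqP; ring.
rewrite sumEFin lee_fin -mulr_sumr.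
have -> : dyadic_mass * m = 4 * r * m * (1 - r / 2)^-1 by rewrite /dyadic_mass; ring.
apply: ler_wpM2l; first by rewrite !mulr_ge0// ltW.
have := @geometric_le_lim R N 1 (r / 2) ler01.
rewrite seriesEnat/= mul1r; under eq_bigr do rewrite mul1r; apply; first by rewrite divr_gt0.
by rewrite ger0_norm ?divr_ge0 ?(ltW r0)// ltr_pdivrMr// mul1r.
Qed.

End sublevel_decay.

Section power_weights.
Context (R : realType) (n : nat) (i0 : 'I_n).
Local Notation mu := (@lebesgue_Rn R n).
Implicit Types (Q : set (Rn R n)) (x : Rn R n).

Definition slab (d : R) : set (Rn R n) := sublevel (fun x : Rn R n => `|coord x i0|) d.

Lemma measurable_norm_coord : measurable_fun setT (fun x : Rn R n => `|coord x i0|).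
Proof. exact: (measurable_norm (measurable_coord i0)). Qed.

Lemma measurable_slab d : measurable (slab d).
Proof. exact: (measurable_sublevel measurable_norm_coord). Qed.

Lemma lebesgue_slab_le a (l d : R) Q : in_cube a l Q -> 0 <= d ->
  (mu (Q `&` slab d) <= (2 * d * l ^+ n.-1)%:E)%E.
Proof.
move=> [l0 mQ _ Qa] d0.
pose u i := if i == i0 then - d else a i; pose v i := if i == i0 then d else a i + l.
have uv i : u i <= v i by rewrite /u /v; case: ifP => _; lra.
have := lebesgue_Rn_box (fun=> true) (fun=> false) uv.
have -> : \prod_i (v i - u i) = 2 * d * l ^+ n.-1.
  rewrite (bigD1 i0)//= /u /v eqxx opprK -mulr2n -(mulr_natl d); congr (_ * _).
  rewrite (eq_bigr (fun=> l)); last by move=> i /negbTE ->; rewrite addrAC subrr add0r.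
  by rewrite prodr_const cardC1 card_ord.
move=> <-; apply: le_measure; rewrite ?inE.
- by apply: measurableI => //; exact: measurable_slab.
- exact: measurable_box.
- move=> x [Qx sx] i /=; rewrite itv_boundlr/= !bnd_simp /u /v.
  by case: eqP => [->|_]; [rewrite -ler_norml|exact: Qa].
Qed.

Definition cube_max (a : 'I_n -> R) (l : R) : R := maxr `|a i0| `|a i0 + l|.

Lemma cube_max_gt0 a l : 0 < l -> 0 < cube_max a l.
Proof.
move=> l0; rewrite lt_max !normr_gt0; have [->|//] := eqVneq (a i0) 0.
by rewrite add0r gt_eqF.
Qed.

Lemma le_cube_max a l Q x : in_cube a l Q -> Q x -> `|coord x i0| <= cube_max a l.
Proof.
move=> [_ _ _ Qa] /Qa/(_ i0)/andP[h1 h2]; rewrite /cube_max.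
rewrite le_max; have [h|h] := leP 0 (coord x i0); apply/orP.
  by right; rewrite (ger0_norm h) ler_normr; lra.
by left; rewrite (ltr0_norm h) ler_normr; lra.
Qed.

(** Either the maximum is at least twice the edge, and then [|x_i0|] never drops
    below half of it on the cube, or it is at most twice the edge, and then a
    slab of width [2 t max] is at most a fraction [4 t] of the cube. *)
Lemma slab_fraction a l Q t : in_cube a l Q -> 0 <= t ->
  (mu (Q `&` slab (t * cube_max a l)) <= (4 * t * l ^+ n)%:E)%E.
Proof.
move=> aQ t0; have [l0 mQ Qm Qa] := aQ; set M := cube_max a l.
have M0 : 0 < M := cube_max_gt0 a l0.
have ln0 : 0 < l ^+ n by rewrite exprn_gt0.
(* For [4 * t >= 1] the bound is no better than the measure of the cube. *)
have [t4|t4] := leP 4^-1 t.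
  apply: (@le_trans _ _ (mu Q)).
    by apply: le_measure; rewrite ?inE//; apply: measurableI => //; exact: measurable_slab.
  by rewrite Qm lee_fin ler_peMl ?(ltW ln0)//; lra.
have [Ml|Ml] := leP (2 * l) M.
  rewrite (_ : Q `&` _ = set0); first by rewrite measure0 lee_fin !mulr_ge0// ltW.
  rewrite -subset0 => x [Qx]; rewrite /slab /sublevel /= -/M => xt.
  have /andP[h1 h2] := Qa x Qx i0.
  have : t * M < 4^-1 * M by rewrite ltr_pM2r.
  suff : M - l <= `|coord x i0| by lra.
  rewrite lerBlDr /M /cube_max ge_max; apply/andP; split.
    have -> : a i0 = coord x i0 + (a i0 - coord x i0) by ring.
    by apply: (le_trans (ler_normD _ _)); rewrite lerD2l ler_norml; lra.
  have -> : a i0 + l = coord x i0 + (a i0 + l - coord x i0) by ring.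
  by apply: (le_trans (ler_normD _ _)); rewrite lerD2l ler_norml; lra.
apply: (le_trans (lebesgue_slab_le aQ _)); first by rewrite mulr_ge0// ltW.
have n0 : (0 < n)%N by exact: leq_ltn_trans (ltn_ord i0).
have -> : l ^+ n = l * l ^+ n.-1 by rewrite -exprS prednK.
rewrite lee_fin [X in _ <= X]mulrA.
apply: ler_wpM2r; first by rewrite exprn_ge0// ltW.
have : t * M <= t * (2 * l) by rewrite ler_wpM2l// ltW.
lra.
Qed.

End power_weights.

(** * Powers of a coordinate *)

Lemma measurable_powR_comp d (T : measurableType d) (R : realType) (f : T -> R) b :
  measurable_fun setT f -> measurable_fun setT (fun x => f x `^ b).
Proof. by move=> mf; apply: (measurableT_comp (measurable_powR b)). Qed.

Section power_weight_averages.
Context (R : realType) (n : nat) (i0 : 'I_n).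
Local Notation mu := (@lebesgue_Rn R n).
Implicit Types (Q : set (Rn R n)) (x : Rn R n).

Definition power_weight (b : R) : Rn R n -> R := fun x => `|coord x i0| `^ b.

Lemma measurable_power_weight b : measurable_fun setT (power_weight b).
Proof. exact: (measurable_powR_comp b (measurable_norm_coord i0)). Qed.

(** The hyperplane [x_i0 = 0] is a null set, as its intersection with a cube is a
    slab of width zero. *)
Lemma scalar_weight_power_weight b : scalar_weight (power_weight b).
Proof.
split; [exact: measurable_power_weight|by move=> x; exact: powR_ge0|].
pose E (N : nat) : set (Rn R n) :=
  box (fun i => Interval (BSide true (- N.+1%:R)) (BSide false (- N.+1%:R + 2 * N.+1%:R))).
have cE N : in_cube (fun=> - N.+1%:R) (2 * N.+1%:R) (E N).
  by apply: in_cube_box; rewrite mulr_gt0// ltr0n.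
have N0 N : mu.-negligible (E N `&` slab i0 0).
  apply/negligibleP; first by apply: measurableI; [exact: measurable_box|exact: measurable_slab].
  apply/eqP; rewrite eq_le measure_ge0 andbT.
  by have := lebesgue_slab_le i0 (cE N) (lexx 0); rewrite mulr0 mul0r.
have := negligible_bigcup N0; apply: negligibleS => x /= xn.
have x0 : coord x i0 = 0.
  apply: contrapT => /eqP x0; apply: xn.
  by rewrite powR_gt0// normr_gt0.
exists (truncn (enorm x)) => //; split; last by rewrite /slab/sublevel/= x0 normr0.
move=> i; rewrite itv_boundlr/= !bnd_simp.
have : `|coord x i| <= (truncn (enorm x)).+1%:R.
  by apply: (le_trans (le_coord_enorm x i)); exact/ltW/truncnS_gt.
by rewrite ler_norml; lra.
Qed.

Variables (c : R) (c0 : 0 < c) (c1 : c < 1).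
Local Notation D := (dyadic (fun x : Rn R n => `|coord x i0|) c).

Lemma fint_dyadic_le a l Q : in_cube a l Q ->
  (fint Q (D (cube_max i0 a l)) <= (dyadic_mass c)%:E)%E.
Proof.
move=> aQ; have [l0 mQ Qm _] := aQ; have ln0 : 0 < l ^+ n by rewrite exprn_gt0.
rewrite /fint Qm inver gt_eqF// lee_pdivrMl// -EFinM mulrC.
apply: (@integral_dyadic_le _ _ _ mu _ (measurable_norm_coord i0) c c0 c1 Q _ (l ^+ n)) => //.
  exact: ltW.
by move=> t t0; exact: slab_fraction.
Qed.

(** With [y = M / |x_i0| >= 1], the logarithm of the inverse weight is
    [- b * ln M + b * ln y], and [ln y <= y ^ c / c]. Both sides are infinite
    where [x_i0 = 0]. *)
Lemma lne_inv_power_weight_le a l Q b x : in_cube a l Q -> Q x -> b != 0 ->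
  (lne (inv_weight (power_weight b) x) <=
   (- b * ln (cube_max i0 a l))%:E + (`|b| / c)%:E * D (cube_max i0 a l) x)%E.
Proof.
move=> aQ Qx b0; have [l0 _ _ _] := aQ; set M := cube_max i0 a l.
have M0 : 0 < M := cube_max_gt0 i0 a l0.
have bc0 : 0 < `|b| / c by rewrite divr_gt0 ?normr_gt0.
rewrite /inv_weight /power_weight.
have [x0|x0] := eqVneq (coord x i0) 0.
  rewrite (dyadic_eqy c0 (ltW M0)); last by rewrite x0 normr0.
  by rewrite gt0_muley ?lte_fin// addey// leey.
have u0 : 0 < `|coord x i0| by rewrite normr_gt0.
have uM := le_cube_max i0 aQ Qx; rewrite -/M in uM.
rewrite inver powR_eq0 (gt_eqF u0) andFb.
rewrite lne_EFin ?invr_gt0 ?powR_gt0// lnV ?posrE ?powR_gt0// ln_powR.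
apply: (@le_trans _ _ ((- b * ln M)%:E +
  (`|b| / c)%:E * ((M / `|coord x i0|) `^ c)%:E)%E); last first.
  apply: leeD => //; apply: lee_wpmul2l; first by rewrite lee_fin ltW.
  exact: (dyadic_ge_powR (u := fun x : Rn R n => `|coord x i0|) c0).
rewrite -EFinM -EFinD lee_fin.
set y := M / `|coord x i0|.
have y0 : 0 < y by rewrite divr_gt0.
have lny : ln y = ln M - ln `|coord x i0| by rewrite ln_div ?posrE.
have y1 : 0 <= ln y by rewrite ln_ge0// ler_pdivlMr// mul1r.
have : c * ln y <= y `^ c by rewrite -ln_powR ltW// ln_sublinear// powR_gt0.
rewrite mulrC -ler_pdivlMr// => h.
have h2 : b * ln y <= `|b| * (y `^ c / c).
  apply: (@le_trans _ _ (`|b| * ln y)); first by rewrite ler_wpM2r// ler_norm.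
  by rewrite ler_wpM2l.
have -> : `|b| / c * y `^ c = `|b| * (y `^ c / c) by rewrite mulrAC mulrA.
by move: h2; rewrite lny mulrBr; lra.
Qed.

Lemma log_factor_power_weight_le a l Q b : in_cube a l Q -> b != 0 ->
  (log_factor (power_weight b) Q <=
   (cube_max i0 a l `^ (- b) * expR (`|b| / c * dyadic_mass c))%:E)%E.
Proof.
move=> aQ b0; have [l0 mQ Qm _] := aQ; set M := cube_max i0 a l.
have M0 : 0 < M := cube_max_gt0 i0 a l0.
have bc0 : 0 < `|b| / c by rewrite divr_gt0 ?normr_gt0.
have fD := fint_dyadic_le aQ.
rewrite /powR gt_eqF// -expRD -[X in (_ <= X)%E]/(expeR (_)%:E) lee_expeR.
apply: (@le_trans _ _ (fint Q (fun x => (- b * ln M)%:E + (`|b| / c)%:E * D M x)%E)).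
  by apply: fint_le => x Qx; exact: (lne_inv_power_weight_le aQ Qx b0).
rewrite (fint_affine _ mQ Qm); last 5 first.
- by rewrite exprn_gt0.
- exact: (measurable_dyadic (measurable_norm_coord i0)).
- by move=> x _; exact: dyadic_ge0.
- by apply: (le_lt_trans fD); exact: ltry.
- exact: ltW.
rewrite EFinD; apply: leeD => //; rewrite [X in (_ <= X)%E]EFinM.
by apply: lee_wpmul2l; [rewrite lee_fin ltW|exact: fD].
Qed.

Lemma fint_power_weight_le a l Q : in_cube a l Q ->
  (fint Q (EFin \o power_weight (- c)) <=
   (cube_max i0 a l `^ (- c) * dyadic_mass c)%:E)%E.
Proof.
move=> aQ; have [l0 mQ Qm _] := aQ; set M := cube_max i0 a l.
have M0 : 0 < M := cube_max_gt0 i0 a l0.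
have Mc0 : 0 <= M `^ (- c) by exact: powR_ge0.
have fD := fint_dyadic_le aQ.
apply: (@le_trans _ _ (fint Q (fun x => 0%:E + (M `^ (- c))%:E * D M x)%E)).
  apply: fint_le => x Qx; rewrite add0e /= /power_weight.
  have [x0|x0] := eqVneq (coord x i0) 0.
    rewrite x0 normr0 powR0 ?oppr_eq0 ?gt_eqF//.
    by rewrite mule_ge0// ?lee_fin// dyadic_ge0.
  have u0 : 0 < `|coord x i0| by rewrite normr_gt0.
  have uM := le_cube_max i0 aQ Qx; rewrite -/M in uM.
  apply: (@le_trans _ _ ((M `^ (- c))%:E * ((M / `|coord x i0|) `^ c)%:E)%E).
    rewrite -EFinM lee_fin powRM ?(ltW M0) ?invr_ge0// mulrA -powRD; last first.
      by apply/implyP => _; rewrite gt_eqF.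
    by rewrite addNr powRr0 mul1r -powR_inv1// -powRrM mulN1r.
  by apply: lee_wpmul2l => //; exact: (dyadic_ge_powR (u := fun x : Rn R n => `|coord x i0|) c0).
rewrite (fint_affine _ mQ Qm); last 5 first.
- by rewrite exprn_gt0.
- exact: (measurable_dyadic (measurable_norm_coord i0)).
- by move=> x _; exact: dyadic_ge0.
- by apply: (le_lt_trans fD); exact: ltry.
- by [].
by rewrite add0e EFinM; apply: lee_wpmul2l.
Qed.

End power_weight_averages.

Section singularities.
Context (R : realType) (n : nat) (i0 : 'I_n).
Local Notation mu := (@lebesgue_Rn R n).

Definition unit_cube : set (Rn R n) :=
  box (fun i => Interval (BSide true 0) (BSide false (0 + 1))).

Lemma cube_unit_cube : cube unit_cube.
Proof. by exists (fun=> 0), 1, (fun=> true), (fun=> false). Qed.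

(** On the part of the unit cube where [0 < x_i0 <= e], of measure [e], the
    integrand of the modular at [l] is at least [(e ^ (- b) / l) ^ s] once the
    base exceeds [1]. Its product with [e] is unbounded as [e] tends to zero, because [b * s > 1]. *)
Lemma vnorm_singular_eqy (q : Rn R n -> R) (f : Rn R n -> \bar R) (b s : R) :
  0 < b -> 0 < s -> 1 < b * s -> (forall x, s <= q x) ->
  (forall x, 0 < coord x i0 <= 1 -> ((coord x i0 `^ (- b))%:E <= f x)%E) ->
  vnorm (EFin \o q) (f \_ unit_cube) = +oo%E.
Proof.
move=> b0 s0 bs sq fb; apply: vnorm_eqy => l [l0 hl].
(* The two summands in the parenthesis make [e ^ (- b) >= l] and
   [e * (e ^ (- b) / l) ^ s > 1] for [e = expR (- t)]. *)
pose t := `|ln l| * (b^-1 + s / (b * s - 1)) + 1.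
have bs0 : 0 < b * s - 1 by lra.
have w0 : 0 <= `|ln l| by [].
have bt : `|ln l| <= b * t.
  have -> : b * t = `|ln l| + (`|ln l| * (b * (s / (b * s - 1))) + b).
    by rewrite /t; field; rewrite !gt_eqF.
  by rewrite lerDl addr_ge0 ?mulr_ge0 ?invr_ge0 ?(ltW b0) ?(ltW s0) ?(ltW bs0)//.
have st : s * `|ln l| < (b * s - 1) * t.
  have -> : (b * s - 1) * t = s * `|ln l| + (`|ln l| * ((b * s - 1) / b) + (b * s - 1)).
    by rewrite /t; field; rewrite !gt_eqF.
  by rewrite ltrDl ltr_wpDl ?mulr_ge0 ?invr_ge0 ?(ltW b0) ?(ltW s0) ?(ltW bs0)//.
have t0 : 0 < t.
  by rewrite /t ltr_wpDl ?mulr_ge0 ?addr_ge0 ?invr_ge0 ?divr_ge0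
    ?(ltW b0) ?(ltW s0) ?(ltW bs0).
pose e := expR (- t).
have e0 : 0 < e := expR_gt0 _.
have e1 : e <= 1 by rewrite -expR0 ler_expR oppr_le0 ltW.
pose V := expR (b * t - ln l).
have V1 : 1 <= V by rewrite -expR0 ler_expR subr_ge0 (le_trans (ler_norm _)).
have Vs : 1 < V `^ s * e.
  rewrite /V -expRM -expRD -expR0 ltr_expR.
  have : s * ln l <= s * `|ln l| by rewrite ler_wpM2l ?(ltW s0)// ler_norm.
  rewrite mulrBl (mulrC (ln l)); lra.
pose v i : R := if i == i0 then e else 1.
pose B : set (Rn R n) := box (fun i => Interval (BSide (i != i0) 0) (BSide false (v i))).
have muB : mu B = e%:E.
  rewrite lebesgue_Rn_box; last by move=> i; rewrite /v; case: ifP => _; [exact: ltW|].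
  congr (_%:E); rewrite (bigD1 i0)//= /v eqxx subr0 big1 ?mulr1// => i /negbTE ->.
  by rewrite subr0.
have mB : measurable B by exact: measurable_box.
suff : ((V `^ s * e)%:E <= 1)%E by rewrite lee_fin leNgt Vs.
apply: le_trans hl; rewrite EFinM -muB -integral_cst//.
rewrite integral_mkcond; apply: le_integral_pointwise => x _.
rewrite [in X in (X <= _)%E]/patch; case: ifPn => [xB|_]; last exact: epow_ge0.
have Bx : B x := set_mem xB.
have x0e : 0 < coord x i0 <= e.
  by have := Bx i0; rewrite itv_boundlr/= /v eqxx !bnd_simp.
have xQ : x \in unit_cube.
  apply/mem_set => i; have := Bx i; rewrite !itv_boundlr/= /v.
  case: eqP => _; rewrite !bnd_simp add0r => /andP[h1 h2]; apply/andP; split; lra.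
rewrite patchE xQ.
have /andP[x0 xe] := x0e.
have fx : ((coord x i0 `^ (- b))%:E <= f x)%E by apply: fb; rewrite x0; lra.
have Vx : (V%:E <= `|f x * l^-1%:E|)%E.
  rewrite gee0_abs; last first.
    apply: mule_ge0; last by rewrite lee_fin invr_ge0 ltW.
    by apply: le_trans fx; rewrite lee_fin powR_ge0.
  apply: (@le_trans _ _ ((coord x i0 `^ (- b))%:E * l^-1%:E)%E); last first.
    by apply: lee_wpmul2r => //; rewrite lee_fin invr_ge0 ltW.
  rewrite -EFinM lee_fin /V expRB lnK ?posrE//.
  apply: ler_wpM2r; first by rewrite invr_ge0 ltW.
  rewrite /powR gt_eqF// ler_expR mulNr -mulrN ler_wpM2l ?(ltW b0)//.
  by rewrite lerNr -ler_expR lnK ?posrE.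
apply: (@le_trans _ _ (epow V%:E (q x)%:E)).
  by rewrite /= lee_fin ler_powR.
apply: le_epow => //; first by apply: lt_le_trans (sq x).
by rewrite lee_fin; lra.
Qed.

End singularities.

(** * The inclusions and their strictness *)

Section measurable_reciprocals.
Context d (T : measurableType d) (R : realType).
Implicit Types (f : T -> R).

Lemma measurable_inve_EFin f : measurable_fun setT f -> (forall x, 0 <= f x) ->
  measurable_fun setT (fun x => (f x)%:E^-1)%E.
Proof.
move=> mf f0.
rewrite (_ : (fun x => _) = fun x =>
    if f x == 0 then +oo%E else (f x `^ (-1))%:E); last first.
  by apply/funext => x; rewrite inver powR_inv1.
apply: measurable_fun_ifT => //=; first exact: measurable_fun_eqr.
by apply/measurable_EFinP; exact: measurable_powR_comp.
Qed.

Lemma measurable_conj f : measurable_fun setT f -> (forall x, 1 < f x) ->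
  measurable_fun setT (fun x => f x / (f x - 1)).
Proof.
move=> mf f1.
rewrite (_ : (fun x => _) = fun x => f x * (f x - 1) `^ (-1)); last first.
  by apply/funext => x; rewrite powR_inv1// subr_ge0 ltW.
apply: measurable_funM => //; apply: measurable_powR_comp.
exact: measurable_funB.
Qed.

End measurable_reciprocals.

Lemma ereal_sup_ltyP (R : realType) (S : set (\bar R)) :
  (ereal_sup S < +oo)%E <-> exists M : R, forall x, S x -> (x <= M%:E)%E.
Proof.
split=> [|[M SM]]; last first.
  by apply: (@le_lt_trans _ _ M%:E); [exact: ge_ereal_sup|exact: ltry].
case E : (ereal_sup S) => [M| |]// _.
  by exists M => x Sx; rewrite -E; exact: ereal_sup_ubound.
exists 0 => x Sx; have : (x <= ereal_sup S)%E by exact: ereal_sup_ubound.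
by rewrite E leeNy_eq => /eqP ->; exact: leNye.
Qed.

Lemma le_mulY (R : realType) (u v : \bar R) (a b : R) :
  (0 <= u)%E -> (0 <= v)%E -> (u <= a%:E)%E -> (v <= b%:E)%E ->
  (mulY u v <= (a * b)%:E)%E.
Proof.
move=> u0 v0 ua vb; rewrite /mulY !lt_eqF ?(le_lt_trans ua) ?(le_lt_trans vb) ?ltry//=.
by rewrite EFinM; apply: lee_pmul.
Qed.

Section inclusions.
Context (R : realType) (n : nat) (n_gt0 : (0 < n)%N).
Local Notation mu := (@lebesgue_Rn R n).
Variable q : Rn R n -> R.
Hypothesis mq : measurable_fun setT q.
Hypothesis q1 : forall x, 1 < q x.

Let mq' : measurable_fun setT (conjr q).
Proof. exact: measurable_conj. Qed.

Let q'1 x : 1 < conjr q x. Proof. exact: conjr_gt1. Qed.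

Let qq' x : (q x)^-1 + (conjr q x)^-1 = 1. Proof. exact: conjrV. Qed.

Let q'q x : (conjr q x)^-1 + (q x)^-1 = 1. Proof. by rewrite addrC qq'. Qed.

Lemma conj_exponentE : conj_exponent (EFin \o q) = EFin \o conjr q.
Proof.
apply/funext => x; rewrite /conj_exponent /hoelder_conjugate /=.
rewrite eqe gt_eqF; last by have := q1 x; lra.
by rewrite -EFinB inver subr_eq0 gt_eqF.
Qed.

Local Notation N Q := (vnorm (EFin \o q) (cst 1%E \_ Q)).

(** Positivity follows from Hoelder's inequality for the indicator itself: its two
    norms are finite and bound the measure of the cube. *)
Lemma vnorm_indic_fin Q : cube Q -> exists2 v : R, 0 < v & N Q = v%:E.
Proof.
move=> /cube_in_cube[a [l [l0 mQ Qm _]]].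
have Qoo : (mu Q < +oo)%E by rewrite Qm ltry.
have fin (r : Rn R n -> R) : (forall x, 1 < r x) ->
    exists2 v : R, 0 <= v & vnorm (EFin \o r) (cst 1%E \_ Q) = v%:E.
  move=> r1; apply: ge0_neqy_EFin; first exact: vnorm_ge0.
  by rewrite -ltey; apply: vnorm_indic_lty => // x; exact: ltW.
have [v v0 vE] := fin q q1; have [v' v'0 v'E] := fin _ q'1.
exists v => //; rewrite lt_neqAle v0 andbT eq_sym; apply/eqP => vz.
have := hoelder_indic q1 q'1 mq mq' qq' mQ (measurable_cst 1%E) (fun=> lee01).
rewrite integral_cst//= mul1e Qm vE v'E /mulY/= -!EFinM lee_fin vz mul0r mulr0.
by rewrite leNgt exprn_gt0.
Qed.

Lemma scalar_weight_inv w : scalar_weight w ->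
  measurable_fun setT (inv_weight w) /\ forall x : Rn R n, (0 <= inv_weight w x)%E.
Proof.
move=> [mw w0 _]; split; first exact: measurable_inve_EFin.
by move=> x; rewrite /inv_weight inve_ge0 lee_fin.
Qed.

Lemma log_factor_ge0 (w : Rn R n -> R) Q : (0 <= log_factor w Q)%E.
Proof. exact: expeR_ge0. Qed.

(** By Jensen's and Hoelder's inequalities the exponential mean of [w^-1] is at
    most a dual norm of [w^-1] times the norm of the indicator, which the
    normalisation of the larger class divides out. *)
Lemma Ap_sub_Apinfty : Ap (EFin \o q) `<=` Apinfty (EFin \o q).
Proof.
move=> w [ww /ereal_sup_ltyP[M HM]]; split => //.
apply/ereal_sup_ltyP; exists (2 * M) => _ [Q cQ <-].
have := HM _ (imageP _ cQ); rewrite conj_exponentE.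
have [v v0 vE] := vnorm_indic_fin cQ.
have [a [l [l0 mQ Qm _]]] := cube_in_cube cQ.
have m0 : 0 < l ^+ n by rewrite exprn_gt0.
have [mi i0] := scalar_weight_inv ww.
set A := vnorm _ ((EFin \o w) \_ Q); set B := vnorm _ (inv_weight w \_ Q).
rewrite Qm vE !inver !gt_eqF//= => H.
have [Aoo Boo AB] : [/\ (A < +oo)%E, (B < +oo)%E & mulY A B = (A * B)%E].
  apply: mulY_lty; rewrite ltey; apply/eqP => E; move: H.
  by rewrite E gt0_muley ?lte_fin ?invr_gt0// leye_eq.
have [x x0 xE] := ge0_neqy_EFin (vnorm_ge0 _ _ : (0 <= A)%E) (negbT (lt_eqF Aoo)).
have [y y0 yE] := ge0_neqy_EFin (vnorm_ge0 _ _ : (0 <= B)%E) (negbT (lt_eqF Boo)).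
move: H; rewrite AB xE yE -!EFinM lee_fin => H.
have LF : (log_factor w Q <= ((l ^+ n)^-1 * (2 * (y * v)))%:E)%E.
  apply: (@le_trans _ _ (fint Q (inv_weight w))).
    by apply: (expeR_fint_lne_le mQ Qm m0) => //; exact: measurable_funTS.
  rewrite /fint Qm inver gt_eqF// EFinM.
  apply: lee_wpmul2l; first by rewrite lee_fin invr_ge0 ltW.
  apply: le_trans (hoelder_indic q'1 q1 mq' mq q'q mQ (measurable_funTS mi) i0) _.
  by rewrite -/B yE vE.
apply: (@le_trans _ _ (v^-1%:E * (x * ((l ^+ n)^-1 * (2 * (y * v))))%:E)%E).
  apply: lee_wpmul2l; first by rewrite lee_fin invr_ge0 ltW.
  by apply: le_mulY => //; exact: log_factor_ge0.
rewrite -EFinM lee_fin.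
have -> : v^-1 * (x * ((l ^+ n)^-1 * (2 * (y * v)))) = 2 * ((l ^+ n)^-1 * (x * y)).
  by field; rewrite !gt_eqF.
by rewrite ler_wpM2l.
Qed.

(** Hoelder's inequality against the indicator of the cube, whose two norms
    multiply to the measure of the cube up to a constant. *)
Lemma Apinfty_sub_Ainfty K : 0 < K ->
  (forall Q, cube Q ->
    (N Q * vnorm (EFin \o conjr q) (cst 1%E \_ Q) <= K%:E * mu Q)%E) ->
  Apinfty (EFin \o q) `<=` @Ainfty R n.
Proof.
move=> K0 HK w [ww /ereal_sup_ltyP[M HM]]; split => //.
apply/ereal_sup_ltyP; exists (2 * K * M) => _ [Q cQ <-].
have := HM _ (imageP _ cQ); have := HK _ cQ.
have [v v0 vE] := vnorm_indic_fin cQ.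
have [a [l [l0 mQ Qm _]]] := cube_in_cube cQ.
have m0 : 0 < l ^+ n by rewrite exprn_gt0.
have [mw w0 _] := ww.
have V'0 := vnorm_ge0 (conjr q) (cst 1%E \_ Q).
set A := vnorm _ ((EFin \o w) \_ Q); set V' := vnorm _ _ in V'0 *.
rewrite Qm vE inver gt_eqF//= => HV H.
have V'oo : V' != +oo%E.
  by apply/eqP => E; move: HV; rewrite E gt0_muley ?lte_fin// -EFinM leye_eq.
have [v' v'0 v'E] := ge0_neqy_EFin V'0 V'oo.
have [Aoo Loo AL] : [/\ (A < +oo)%E, (log_factor w Q < +oo)%E &
    mulY A (log_factor w Q) = (A * log_factor w Q)%E].
  apply: mulY_lty; rewrite ltey; apply/eqP => E; move: H.
  by rewrite E gt0_muley ?lte_fin ?invr_gt0// leye_eq.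
have [x x0 xE] := ge0_neqy_EFin (vnorm_ge0 _ _ : (0 <= A)%E) (negbT (lt_eqF Aoo)).
have [y y0 yE] := ge0_neqy_EFin (log_factor_ge0 w Q) (negbT (lt_eqF Loo)).
move: H HV; rewrite AL xE yE v'E -!EFinM !lee_fin => H HV.
have W : (fint Q (EFin \o w) <= ((l ^+ n)^-1 * (2 * (x * v')))%:E)%E.
  rewrite /fint Qm inver gt_eqF// EFinM.
  apply: lee_wpmul2l; first by rewrite lee_fin invr_ge0 ltW.
  have mw' : measurable_fun Q (EFin \o w) by apply/measurable_EFinP; exact: measurable_funTS.
  have w0' z : (0 <= (EFin \o w) z)%E by rewrite lee_fin.
  apply: le_trans (hoelder_indic q1 q'1 mq mq' qq' mQ mw' w0') _.
  by rewrite -/A -/V' xE v'E.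
apply: (@le_trans _ _ ((l ^+ n)^-1 * (2 * (x * v')) * y)%:E).
  apply: le_mulY => //.
  apply: mule_ge0; first by rewrite inve_ge0 measure_ge0.
  by apply: integral_ge0 => z _; rewrite lee_fin.
rewrite lee_fin.
have -> : (l ^+ n)^-1 * (2 * (x * v')) * y =
   2 * (v^-1 * (x * y)) * ((l ^+ n)^-1 * (v * v')).
  by field; rewrite !gt_eqF.
apply: (@le_trans _ _ (2 * (v^-1 * (x * y)) * K)).
  apply: ler_wpM2l; first by rewrite !mulr_ge0// invr_ge0 ltW.
  by rewrite ler_pdivrMl// [X in _ <= X]mulrC.
by rewrite mulrAC ler_wpM2l// mulr_ge0// ltW.
Qed.

Let i0 := Ordinal n_gt0.

(** The norm of the weight on a cube is at most its maximum there times the norm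
    of the indicator, and [log_factor] compensates that maximum. *)
Lemma power_weight2_Apinfty : Apinfty (EFin \o q) (power_weight i0 2).
Proof.
split; first exact: scalar_weight_power_weight.
have c0 : 0 < 2^-1 :> R by rewrite invr_gt0.
have c1 : 2^-1 < 1 :> R by rewrite invf_lt1// ltr1n.
apply/ereal_sup_ltyP; exists (expR (`|2| / 2^-1 * dyadic_mass (2^-1))) => _ [Q cQ <-].
have [v v0 vE] := vnorm_indic_fin cQ.
have [a [l aQ]] := cube_in_cube cQ; have [l0 _ _ _] := aQ.
have two0 : 2 != 0 :> R by rewrite pnatr_eq0.
have LF := log_factor_power_weight_le i0 c0 c1 aQ two0.
set M := cube_max i0 a l in LF; set E := expR _ in LF *.
have M0 : 0 < M := cube_max_gt0 i0 a l0.
have A : (vnorm (EFin \o q) ((EFin \o power_weight i0 2) \_ Q) <= (M `^ 2 * v)%:E)%E.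
  rewrite EFinM -vE; apply: vnorm_bounded_le; first by move=> x; exact: ltW.
    exact: powR_gt0.
  move=> x Qx; rewrite !lee_fin powR_ge0/=.
  by rewrite ge0_ler_powR// ?nnegrE ?(ltW M0)//; exact: (le_cube_max i0 aQ).
rewrite vE inver gt_eqF//.
apply: (@le_trans _ _ (v^-1%:E * (M `^ 2 * v * (M `^ (- 2) * E))%:E)%E).
  apply: lee_wpmul2l; first by rewrite lee_fin invr_ge0 ltW.
  by apply: le_mulY => //; [exact: vnorm_ge0|exact: log_factor_ge0].
rewrite -EFinM lee_fin powRN.
have M2 : 0 < M `^ 2 by exact: powR_gt0.
by rewrite le_eqVlt; apply/orP; left; apply/eqP; field; rewrite !gt_eqF.
Qed.

Lemma power_weight2_notin_Ap : ~ Ap (EFin \o q) (power_weight i0 2).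
Proof.
move=> [_ /ereal_sup_ltyP[M HM]]; have := HM _ (imageP _ (cube_unit_cube R n)).
have [a [l [l0 mQ Qm _]]] := cube_in_cube (cube_unit_cube R n).
have m0 : 0 < l ^+ n by rewrite exprn_gt0.
rewrite conj_exponentE.
rewrite [X in mulY _ X](@vnorm_singular_eqy _ _ i0 _ _ 2 1)//; last 3 first.
- by rewrite mulr1 ltr1n.
- by move=> x; exact: ltW.
- move=> x /andP[x0 _]; rewrite /inv_weight /power_weight gtr0_norm//.
  by rewrite inver gt_eqF ?powR_gt0// powRN.
by rewrite /mulY eqxx orbT Qm inver gt_eqF// gt0_muley ?lte_fin ?invr_gt0// leye_eq.
Qed.

Lemma power_weight_Ainfty c : 0 < c -> c < 1 -> @Ainfty R n (power_weight i0 (- c)).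
Proof.
move=> c0 c1; split; first exact: scalar_weight_power_weight.
apply/ereal_sup_ltyP.
exists (dyadic_mass c * expR (`|- c| / c * dyadic_mass c)) => _ [Q cQ <-].
have [a [l aQ]] := cube_in_cube cQ; have [l0 mQ _ _] := aQ.
have cn0 : - c != 0 by rewrite oppr_eq0 gt_eqF.
have LF := log_factor_power_weight_le i0 c0 c1 aQ cn0.
have W := fint_power_weight_le i0 c0 c1 aQ.
apply: (le_trans (le_mulY _ _ W LF)).
- apply: mule_ge0; first by rewrite inve_ge0 measure_ge0.
  by apply: integral_ge0 => x _; rewrite lee_fin powR_ge0.
- exact: log_factor_ge0.
have M0 : 0 < cube_max i0 a l `^ c by apply: powR_gt0; exact: cube_max_gt0.
rewrite lee_fin opprK powRN le_eqVlt; apply/orP; left; apply/eqP.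
by field; rewrite gt_eqF.
Qed.

Lemma power_weight_notin_Apinfty c s : 0 < c -> 0 < s -> 1 < c * s ->
  (forall x, s <= q x) -> ~ Apinfty (EFin \o q) (power_weight i0 (- c)).
Proof.
move=> c0 s0 cs sq [_ /ereal_sup_ltyP[M HM]].
have := HM _ (imageP _ (cube_unit_cube R n)).
have [v v0 vE] := vnorm_indic_fin (cube_unit_cube R n).
rewrite vE [X in mulY X _](@vnorm_singular_eqy _ _ i0 _ _ c s)//; last first.
  by move=> x /andP[x0 _]; rewrite lee_fin /power_weight gtr0_norm.
by rewrite /mulY eqxx inver gt_eqF// gt0_muley ?lte_fin ?invr_gt0// leye_eq.
Qed.

End inclusions.

Theorem proposition2p42 (R : realType) (n : nat) (n_gt0 : (0 < n)%N)
    (p : Rn R n -> \bar R) (p_exponent : exponent p)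
    (p_fin : forall x, p x \is a fin_num) (p_LH : LH (fine \o p))
    (p_minus_gt1 : (1 < ess_inf (@lebesgue_Rn R n) p)%E) :
  (Ap p `<` Apinfty p) /\ (Apinfty p `<` @Ainfty R n).
Proof.
pose q := fine \o p.
have pE : p = EFin \o q by apply/funext => x; rewrite /= fineK.
have [mq [C C0 loc] [q_oo [C' [_ C'0 inf]]]] := p_LH.
have [s s1 sp] : exists2 s : R, 1 < s & (s%:E <= ess_inf (@lebesgue_Rn R n) p)%E.
  move: p_minus_gt1; case: (ess_inf _ _) => [e|_|//]; last by exists 2; rewrite ?leey ?ltr1n.
  by rewrite lte_fin => e1; exists e.
have sq : forall x, s <= q x.
  apply: (locally_lh_ae_ge n_gt0 (ltW C0) loc).
  move/ess_infP : sp; apply: filterS => x.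
  by rewrite pE lee_fin.
have q1 x : 1 < q x by apply: lt_le_trans (sq x).
have s_oo := lh_limit_ge n_gt0 C'0 sq inf.
have [K K0 HK] := vnorm_indic_mul_conj n_gt0 s1 sq s_oo (ltW C0) C'0 loc inf.
have [c /andP[sc c1]] : exists c, s^-1 < c < 1.
  exists ((s^-1 + 1) / 2); have : s^-1 < 1 by rewrite invf_lt1//; lra.
  lra.
have c0 : 0 < c by apply: lt_trans sc; rewrite invr_gt0; lra.
have cs : 1 < c * s by rewrite -ltr_pdivrMr ?div1r//; lra.
rewrite pE; split; split.
- exact: Ap_sub_Apinfty.
- move=> /(_ _ (power_weight2_Apinfty n_gt0 mq q1)).
  exact: power_weight2_notin_Ap.
- exact: (Apinfty_sub_Ainfty mq q1 K0 HK).
- move=> /(_ _ (power_weight_Ainfty n_gt0 c0 c1)).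
  apply: (power_weight_notin_Apinfty mq q1 c0 _ cs sq); lra.
Qed.
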